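(* Let $\Omega\subset\mathbb{R}^2$ be a bounded simply connected domain with boundary $\Gamma=\{\gamma(t): t\in[0,2\pi)\}$ of class $C^2$, and let $\varphi\in C(\Gamma)$ be a real-valued function. Let $\psi\in C(\Gamma)$ be the complex-valued function defined in complex parametric form by $\psi\circ\gamma=(\varphi\circ\gamma)\frac{|\gamma'|}{\gamma'}$, let $N\ge0$ be an integer, and assume that both $\gamma$ and $\psi\circ\gamma$ are $N$ times continuously differentiable at $t_0\in[0,2\pi)$. Put $z_0=\gamma(t_0)\in\Gamma$ and let $\Omega'=\mathbb{C}\setminus\overline{\Omega}$. Let $\log(\cdot-z)$ be defined so that its branch-cut path: - if $z\in\Omega$, starts at $z$, exits $\Omega$ at $z_0\in\Gamma$, and extends to infinity, meeting $\Gamma$ only at $z_0$; - if $z\in\Omega'$, starts at $z$ and extends to infinity without intersecting $\Gamma$; - if $z\in\Gamma$, starts at $z$ and extends to infinity intersecting $\Gamma$ only at $z$. Then the single-layer potential $\mathcal{S}\varphi$ can be recast as $$(\mathcal{S}\varphi)(\boldsymbol{r})=\mathrm{Im}\left\{\frac{1}{2\pi i}\int_\Gamma\log(\zeta-z)\left\{\psi(\zeta)-Q_N(\zeta,z_0)\right\}\mathrm{d}\zeta-\mathbf{1}_\Omega(z)\int_{z_0}^zQ_N(\eta,z_0)\,\mathrm{d}\eta\right\}$$ for all $\boldsymbol{r}=(\mathrm{Re}\,z,\mathrm{Im}\,z)\in\mathbb{R}^2\setminus\Gamma$, where $Q_N(\cdot,z_0)$ is the $N$th-order $\psi$-interpolant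 at $z_0$. Moreover, assuming that $\gamma$ and $\psi\circ\gamma$ are ($2\pi$-periodic) functions of class $C^N$, the single-layer operator $S$ can be expressed as $$(S\varphi)(\boldsymbol{x})=\mathrm{Im}\left\{\frac{1}{2\pi i}\int_\Gamma\log(\zeta-z)\left\{\psi(\zeta)-Q_N(\zeta,z)\right\}\mathrm{d}\zeta\right\}$$ for all $\boldsymbol{x}=(\mathrm{Re}\,z,\mathrm{Im}\,z)\in\Gamma$, where $Q_N(\cdot,z)$ is the $N$th-order $\psi$-interpolant at $z$.
   Context: $\mathbb{R}^2$ is identified with $\mathbb{C}$ via $(x,y)\leftrightarrow x+iy$, and the same symbols $\Omega$, $\Gamma$, $\varphi$, $\gamma$ denote both the real and the complex versions of an object (e.g. $\varphi(\zeta)=\varphi(\boldsymbol{y})$ for $\boldsymbol{y}=(\mathrm{Re}\,\zeta,\mathrm{Im}\,\zeta)$). The map $\gamma:[0,2\pi)\to\Gamma$ is a counterclockwise, $2\pi$-periodic, regular ($\gamma'\neq0$) $C^2$ parametrization of the Jordan curve $\Gamma=\partial\Omega$; $\gamma$, $\varphi\circ\gamma$ and $\psi\circ\gamma$ are regarded as $2\pi$-periodic functions on $\mathbb{R}$. Contour integrals over $\Gamma$ are taken counterclockwise, and $\mathbf{1}_\Omega$ is the indicator function of $\Omega$. The branch-cut path of $\log(\cdot-z)$ is a simple curve from the branch point $z$ to infinity, off which $\log(\cdot-z)$ is an analytic branch of the logarithm. Single-layer potential and single-layer operator: $$(\mathcal{S}\varphi)(\boldsymbol{r})=-\frac{1}{2\pi}\int_\Gamma\log|\boldsymbol{r}-\boldsymbol{y}|\,\varphi(\boldsymbol{y})\,\mathrm{d}s(\boldsymbol{y}),\quad\boldsymbol{r}\in\mathbb{R}^2\setminus\Gamma,$$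 $$(S\varphi)(\boldsymbol{x})=-\frac{1}{2\pi}\int_\Gamma\log|\boldsymbol{x}-\boldsymbol{y}|\,\varphi(\boldsymbol{y})\,\mathrm{d}s(\boldsymbol{y}),\quad\boldsymbol{x}\in\Gamma.$$ Density interpolant: for a function $\psi:\Gamma\to\mathbb{C}$ and $z_0=\gamma(t_0)\in\Gamma$ such that $\gamma$ and $\psi\circ\gamma$ are $N$ times differentiable at $t_0$, the $N$th-order $\psi$-interpolant at $z_0$ is the unique polynomial $$Q_N(z,z_0)=\sum_{j=0}^N\frac{b_j(z_0)}{j!}(z-z_0)^j,\quad z\in\mathbb{C},$$ with coefficients $b_j(z_0)\in\mathbb{C}$ determined by the interpolation conditions $$\lim_{\tau\to t_0}\frac{\partial^m}{\partial\tau^m}\left[\psi(\gamma(\tau))-Q_N(\gamma(\tau),z_0)\right]=0,\quad m=0,\ldots,N.$$ Since $Q_N(\cdot,z_0)$ is entire, $\int_{z_0}^zQ_N(\eta,z_0)\,\mathrm{d}\eta$ does not depend on the path. *)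

(* Defs.v *)
From Stdlib Require Import Reals Factorial ClassicalEpsilon.
From Coquelicot Require Import Coquelicot.
Open Scope R_scope.

(** The plane is Coquelicot's [C = R * R]; its uniform
    structure is the sup metric of the product, which induces the usual
    topology. *)

Definition closure (D : C -> Prop) (z : C) : Prop :=
  forall P : C -> Prop, locally (T := C_UniformSpace) z P ->
    exists w, D w /\ P w.

Definition frontier (D : C -> Prop) (z : C) : Prop :=
  closure D z /\ closure (fun w => ~ D w) z.

Definition exterior (D : C -> Prop) (z : C) : Prop := ~ closure D z.

Definition bounded_set (D : C -> Prop) : Prop :=
  exists M : R, forall z, D z -> Cmod z <= M.

Definition connected_set (D : C -> Prop) : Prop :=
  forall U V : C -> Prop,
    open (T := C_UniformSpace) U -> open (T := C_UniformSpace) V ->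
    (forall z, D z -> U z \/ V z) ->
    (exists z, D z /\ U z) -> (exists z, D z /\ V z) ->
    exists z, D z /\ U z /\ V z.

Definition domain (D : C -> Prop) : Prop :=
  (exists z, D z) /\ open (T := C_UniformSpace) D /\ connected_set D.

Definition unit_interval (s : R) : Prop := 0 <= s <= 1.

Definition unit_square (us : R * R) : Prop :=
  unit_interval (fst us) /\ unit_interval (snd us).

(** Every closed path in [D] is homotopic in [D], with fixed base point, to a
    constant path; [H (u, s)] is the point of parameter [s] on the [u]-th path. *)
Definition loops_contractible (D : C -> Prop) : Prop :=
  forall p : R -> C,
    continuous_on (T := R_UniformSpace) (U := C_UniformSpace) unit_interval p ->
    (forall s, unit_interval s -> D (p s)) ->
    p 0 = p 1 ->
    exists H : R * R -> C,
      continuous_on (T := prod_UniformSpace R_UniformSpace R_UniformSpace)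
        (U := C_UniformSpace) unit_square H /\
      (forall us, unit_square us -> D (H us)) /\
      (forall s, unit_interval s -> H (0, s) = p s /\ H (1, s) = p 0) /\
      (forall u, unit_interval u -> H (u, 0) = p 0 /\ H (u, 1) = p 0).

Definition simply_connected_domain (D : C -> Prop) : Prop :=
  domain D /\ loops_contractible D.

Definition Cderive_n (f : R -> C) (n : nat) (t : R) : C :=
  (Derive_n (fun s => Re (f s)) n t, Derive_n (fun s => Im (f s)) n t).

Definition Cderive (f : R -> C) (t : R) : C := Cderive_n f 1 t.

Definition ex_Cderive_n (f : R -> C) (n : nat) (t : R) : Prop :=
  ex_derive_n (fun s => Re (f s)) n t /\ ex_derive_n (fun s => Im (f s)) n t.

(** The derivatives up to order [n] exist near [t] and the [n]-th one is
    continuous at [t].  All lower orders are listed because [ex_derive_n f n]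
    only says that the total function [Derive_n f (n - 1)] is differentiable. *)
Definition cont_diff_at (n : nat) (f : R -> C) (t : R) : Prop :=
  locally t (fun s => forall k, (k <= n)%nat -> ex_Cderive_n f k s) /\
  continuous (T := R_UniformSpace) (U := C_UniformSpace) (Cderive_n f n) t.

Definition class_C (n : nat) (f : R -> C) : Prop :=
  forall t, cont_diff_at n f t.

Definition CRInt (f : R -> C) (a b : R) : C :=
  RInt (V := C_R_CompleteNormedModule) f a b.

Definition ex_CRInt (f : R -> C) (a b : R) : Prop :=
  ex_RInt (V := C_R_NormedModule) f a b.

(** Improper integrals over the period that begins and ends at a singular
    parameter [a]. *)

Definition period_int (f : R -> R) (a : R) : R :=
  RInt_gen (V := R_CompleteNormedModule) f
    (at_right a) (at_left (a + 2 * PI)).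

Definition ex_period_int (f : R -> R) (a : R) : Prop :=
  ex_RInt_gen (V := R_NormedModule) f (at_right a) (at_left (a + 2 * PI)).

Definition Cperiod_int (f : R -> C) (a : R) : C :=
  RInt_gen (V := C_R_CompleteNormedModule) f
    (at_right a) (at_left (a + 2 * PI)).

Definition ex_Cperiod_int (f : R -> C) (a : R) : Prop :=
  ex_RInt_gen (V := C_R_NormedModule) f (at_right a) (at_left (a + 2 * PI)).

Definition contour_integrand (gam : R -> C) (f : C -> C) (t : R) : C :=
  (f (gam t) * Cderive gam t)%C.

Definition contour_int (gam : R -> C) (f : C -> C) : C :=
  CRInt (contour_integrand gam f) 0 (2 * PI).

Definition ex_contour_int (gam : R -> C) (f : C -> C) : Prop :=
  ex_CRInt (contour_integrand gam f) 0 (2 * PI).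

(** The same integral when [f] may be singular at the point [gam a]. *)

Definition contour_int_sing (gam : R -> C) (f : C -> C) (a : R) : C :=
  Cperiod_int (contour_integrand gam f) a.

Definition ex_contour_int_sing (gam : R -> C) (f : C -> C) (a : R) : Prop :=
  ex_Cperiod_int (contour_integrand gam f) a.

(** For entire [f] this is the integral from [a] to [b] along any path. *)
Definition segment_int (f : C -> C) (a b : C) : C :=
  CRInt (fun s => (f (a + RtoC s * (b - a)) * (b - a))%C) 0 1.

Definition winding_number (gam : R -> C) (z : C) : C :=
  (/ (RtoC (2 * PI) * Ci) * contour_int gam (fun w => / (w - z)))%C.

(** [gam] is a regular [C^2] Jordan parametrization of the boundary of [D],
    counterclockwise in the sense that it winds once, positively, around each
    point of [D]. *)
Record boundary_param (D : C -> Prop) (gam : R -> C) : Prop := {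
  bp_periodic : forall t, gam (t + 2 * PI) = gam t;
  bp_C2 : class_C 2 gam;
  bp_regular : forall t, Cderive gam t <> RtoC 0;
  bp_simple : forall s t, 0 <= s < 2 * PI -> 0 <= t < 2 * PI ->
    gam s = gam t -> s = t;
  bp_boundary : forall z,
    frontier D z <-> exists t, 0 <= t < 2 * PI /\ gam t = z;
  bp_ccw : forall z, D z -> winding_number gam z = RtoC 1
}.

Definition layer_integrand (gam : R -> C) (phi : C -> R) (r : C) (t : R) : R :=
  ln (Cmod (r - gam t)%C) * phi (gam t) * Cmod (Cderive gam t).

Definition single_layer_potential (gam : R -> C) (phi : C -> R) (r : C) : R :=
  - / (2 * PI) * RInt (V := R_CompleteNormedModule)
                   (layer_integrand gam phi r) 0 (2 * PI).

(** The single-layer operator at the boundary point [gam t]. *)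
Definition single_layer_operator (gam : R -> C) (phi : C -> R) (t : R) : R :=
  - / (2 * PI) * period_int (layer_integrand gam phi (gam t)) t.

Definition taylor_poly (N : nat) (b : nat -> C) (z0 z : C) : C :=
  sum_n (G := C_AbelianMonoid)
    (fun j => (b j / RtoC (INR (fact j)) * Cpow (z - z0) j)%C) N.

(** [taylor_poly N b (gam t0)] is the [N]-th order [psi]-interpolant at
    [gam t0]; only [b 0], ..., [b N] matter. *)
Definition is_interpolant (gam : R -> C) (psi : C -> C) (N : nat) (t0 : R)
    (b : nat -> C) : Prop :=
  forall m, (m <= N)%nat ->
    filterlim
      (Cderive_n
         (fun tau => (psi (gam tau) - taylor_poly N b (gam t0) (gam tau))%C) m)
      (locally' t0) (locally (T := C_UniformSpace) (RtoC 0)).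

Definition Cexp (z : C) : C :=
  (exp (Re z) * cos (Im z), exp (Re z) * sin (Im z)).

(** A simple curve [c], parametrized by [0, +oo[, from [z] to infinity. *)
Definition simple_curve_to_infinity (z : C) (c : R -> C) : Prop :=
  c 0 = z /\
  continuous_on (T := R_UniformSpace) (U := C_UniformSpace)
    (fun s => 0 <= s) c /\
  (forall s s', 0 <= s -> 0 <= s' -> c s = c s' -> s = s') /\
  filterlim (fun s => Cmod (c s))
    (Rbar_locally p_infty) (Rbar_locally p_infty).

Definition on_cut (c : R -> C) (w : C) : Prop := exists s, 0 <= s /\ c s = w.

(** [lg] is an analytic branch of [w |-> log (w - z)] off the curve [c]; its
    values on the curve are arbitrary. *)
Definition log_branch (z : C) (c : R -> C) (lg : C -> C) : Prop :=
  simple_curve_to_infinity z c /\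
  forall w, ~ on_cut c w ->
    ex_derive (K := C_AbsRing) (V := C_NormedModule) lg w /\
    Cexp (lg w) = (w - z)%C.

(** After parameter [s0] the curve stays outside [D] when [D] is bounded, since
    it tends to infinity and meets the frontier only at [z0]. *)
Definition cut_exits_at (D : C -> Prop) (c : R -> C) (z0 : C) : Prop :=
  (exists s0, 0 <= s0 /\ c s0 = z0 /\ forall s, 0 <= s < s0 -> D (c s)) /\
  forall w, on_cut c w -> frontier D w -> w = z0.

Definition cut_avoids_boundary (D : C -> Prop) (c : R -> C) : Prop :=
  forall w, on_cut c w -> ~ frontier D w.

Definition cut_meets_boundary_only_at (D : C -> Prop) (c : R -> C) (z : C) : Prop :=
  forall w, on_cut c w -> frontier D w -> w = z.

Definition indicator (D : C -> Prop) (z : C) : C :=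
  if excluded_middle_informative (D z) then RtoC 1 else RtoC 0.

(* Main.v *)
Require Import Defs.
From Stdlib Require Import Reals ZArith Factorial Lra Lia ClassicalEpsilon.
From Coquelicot Require Import Coquelicot.
Open Scope R_scope.

(** Write [z0] for the base point, [Q] for the interpolant at [z0], and [P] for
    the polynomial primitive of [Q] that vanishes at [z0].

    The density [psi] is chosen so that [psi (gam t) * gam' t] is the real number
    [phi (gam t) * |gam' t|] ([psi_Cderive]).  Since the real part of
    [log (zeta - z)] is [ln |zeta - z|], the real part of the contour integral of
    [log (zeta - z) psi(zeta)] is the layer integral, and dividing by [2 pi i]
    turns it into the imaginary part of the formula.  So everything reduces to
    computing the contour integral of [log (zeta - z) Q(zeta)] for a polynomial [Q].

    That integral has an explicit primitive along the curve.  The quotient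
    [(P(zeta) - P(z)) / (zeta - z)] is a polynomial, with polynomial primitive [V],
    and if [Lam] is a differentiable determination of [log (gam t - z)] then
    [Lam (P(gam) - P(z)) - V(gam)] has derivative [Lam Q(gam) gam']
    ([is_derive_log_by_parts]).

    Off the curve, [Lam] can be chosen differentiable on the whole line and equal to
    the given branch on the open period that starts at the parameter of [z0].  The
    integral over the period is then [- P(z)] times the increment of [Lam]
    ([off_boundary_identity]).  When [z] is exterior the cut misses the curve, so
    [Lam] is the branch itself and its increment is zero.  When [z] is interior the
    increment is [2 pi i] times the winding number, that is [2 pi i], which gives
    the additional term.

    On the curve, [z = z0] and [P(z) = 0].  Regularity of [gam] gives
    [|gam s - gam a| >= k min (s - a, b - s)] on the period [(a, b)], so that the
    derivative of the branch is at most of order [1/(s - a) + 1/(b - s)] and the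
    branch itself at most of order [1/sqrt (s - a) + 1/sqrt (b - s)]
    ([log_growth_at_boundary_point]).  This majorant is integrable, so the
    improper integrals converge, and it is beaten by the zero of
    [P(gam)] at both ends, so the primitive takes the same limit [- V(z0)] at both
    ends and the integral of [log (zeta - z) Q(zeta)] vanishes
    ([on_boundary_identity]). *)

(** * Complex-valued functions of a real variable *)

Notation is_derive_RC := (is_derive (K := R_AbsRing) (V := C_R_NormedModule)).
Notation continuous_RC := (continuous (T := R_UniformSpace) (U := C_UniformSpace)).

Lemma norm_C_R (z : C) : norm (V := C_R_NormedModule) z = Cmod z.
Proof.
  unfold norm, Cmod; simpl; unfold prod_norm, norm; simpl; unfold abs; simpl.
  f_equal; rewrite !Rmult_1_r, <- !Rabs_mult.
  rewrite !Rabs_pos_eq by nra; reflexivity.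
Qed.

Lemma is_derive_RC_iff (f : R -> C) (t : R) (l : C) :
  is_derive_RC f t l <->
  is_derive (fun s => Re (f s)) t (Re l) /\ is_derive (fun s => Im (f s)) t (Im l).
Proof.
  split.
  - intros H; split.
    + apply (filterdiff_comp' (K := R_AbsRing) (V := C_R_NormedModule) f Re t
               (fun y => scal y l) Re H).
      apply filterdiff_linear, is_linear_fst.
    + apply (filterdiff_comp' (K := R_AbsRing) (V := C_R_NormedModule) f Im t
               (fun y => scal y l) Im H).
      apply filterdiff_linear, is_linear_snd.
  - intros [H1 H2].
    apply (filterdiff_ext (fun s => (Re (f s), Im (f s)) : C_R_NormedModule)).
    { intros s; destruct (f s); reflexivity. }
    apply (filterdiff_comp'_2 (K := R_AbsRing) (W := C_R_NormedModule)
             (fun s => Re (f s)) (fun s => Im (f s)) (fun u v => (u, v)) t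
             (fun y => scal y (Re l)) (fun y => scal y (Im l)) (fun u v => (u, v)) H1 H2).
    apply (filterdiff_ext (K := R_AbsRing) (fun x : C_R_NormedModule => x)).
    { intros x; destruct x; reflexivity. }
    apply (filterdiff_ext_lin _ (fun x : C_R_NormedModule => x)).
    + apply filterdiff_id.
    + intros y; destruct y; reflexivity.
Qed.

Lemma continuous_RC_iff (f : R -> C) (t : R) :
  continuous_RC f t <->
  continuous (fun s => Re (f s)) t /\ continuous (fun s => Im (f s)) t.
Proof.
  split.
  - intros H; split.
    + apply (continuous_comp f Re); [exact H | apply continuous_fst].
    + apply (continuous_comp f Im); [exact H | apply continuous_snd].
  - intros [H1 H2].
    apply (continuous_ext (fun s => (Re (f s), Im (f s)) : C_UniformSpace)).
    { intros s; destruct (f s); reflexivity. }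
    apply (continuous_comp_2 (fun s => Re (f s)) (fun s => Im (f s)) (fun u v => (u, v) : C_UniformSpace)); try assumption.
    apply (continuous_ext (fun x : R * R => x)).
    { intros [x y]; reflexivity. }
    apply continuous_id.
Qed.

Lemma is_derive_RC_continuous f t l : is_derive_RC f t l -> continuous_RC f t.
Proof. intros H. apply (ex_derive_continuous (V := C_R_NormedModule)). now exists l. Qed.

Lemma is_derive_RC_unique (f : R -> C) t l l' :
  is_derive_RC f t l -> is_derive_RC f t l' -> l = l'.
Proof.
  rewrite !is_derive_RC_iff; intros [H1 H2] [H1' H2'].
  apply is_derive_unique in H1, H2, H1', H2'.
  apply injective_projections; unfold Re, Im in *; congruence.
Qed.

Lemma is_derive_RC_minus_const (f : R -> C) t l z :
  is_derive_RC f t l -> is_derive_RC (fun s => f s - z)%C t l.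
Proof.
  intros H; evar_last.
  - exact (is_derive_minus (V := C_R_NormedModule) f (fun _ => z) t _ _ H
      (is_derive_const (V := C_R_NormedModule) z t)).
  - apply injective_projections; simpl; unfold minus, plus, opp, zero; simpl; unfold plus, opp, zero; simpl; ring.
Qed.

Lemma is_derive_RC_mult (f g : R -> C) (t : R) (df dg : C) :
  is_derive_RC f t df -> is_derive_RC g t dg ->
  is_derive_RC (fun s => f s * g s)%C t (df * g t + f t * dg)%C.
Proof.
  rewrite !is_derive_RC_iff; intros [F1 F2] [G1 G2]; split; simpl.
  - evar_last.
    apply @is_derive_minus; apply (is_derive_mult (K := R_AbsRing)); eauto; intros; apply Rmult_comm.
    unfold Re, Im, minus, plus, opp, mult; simpl; ring.
  - evar_last.
    apply @is_derive_plus; apply (is_derive_mult (K := R_AbsRing)); eauto; intros; apply Rmult_comm.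
    unfold Re, Im, minus, plus, opp, mult; simpl; ring.
Qed.

Lemma continuous_RC_mult (f g : R -> C) (t : R) :
  continuous_RC f t -> continuous_RC g t -> continuous_RC (fun s => f s * g s)%C t.
Proof.
  rewrite !continuous_RC_iff; intros [F1 F2] [G1 G2]; split; simpl.
  - apply @continuous_minus; apply @continuous_mult; assumption.
  - apply @continuous_plus; apply @continuous_mult; assumption.
Qed.

Lemma continuous_RtoC (f : R -> R) (t : R) :
  continuous f t -> continuous_RC (fun s => RtoC (f s)) t.
Proof.
  intros H; apply continuous_RC_iff; split; simpl; [exact H | apply continuous_const].
Qed.

Lemma continuous_RC_Cmod (f : R -> C) (t : R) :
  continuous_RC f t -> continuous (fun s => Cmod (f s)) t.
Proof.
  intros H.
  apply (continuous_ext (fun s => norm (V := C_R_NormedModule) (f s))).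
  { intros s; apply norm_C_R. }
  apply (continuous_comp f (norm (V := C_R_NormedModule))); [exact H|].
  apply (filterlim_norm (V := C_R_NormedModule)).
Qed.

Lemma continuous_RC_inv (f : R -> C) (t : R) :
  continuous_RC f t -> f t <> RtoC 0 -> continuous_RC (fun s => / f s)%C t.
Proof.
  intros H N; pose proof (proj1 (continuous_RC_iff _ _) H) as [F1 F2].
  assert (D : continuous (fun s => / (fst (f s) ^ 2 + snd (f s) ^ 2)) t).
  { apply continuous_comp.
    - simpl; apply @continuous_plus; apply @continuous_mult; trivial;
      apply @continuous_mult; trivial; apply continuous_const.
    - apply continuous_Rinv. intros E; apply N.
      destruct (f t) as [x y]; simpl in E.
      apply injective_projections; simpl; nra. }
  apply continuous_RC_iff; split; simpl.
  - apply @continuous_mult; [exact F1 | exact D].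
  - apply @continuous_mult; [apply @continuous_opp; exact F2 | exact D].
Qed.

Lemma continuous_quotient (g h : R -> C) z s :
  continuous_RC g s -> continuous_RC h s -> h s <> z -> continuous_RC (fun s => g s / (h s - z))%C s.
Proof.
  intros Hg Hh N; apply continuous_RC_mult; [exact Hg|].
  apply continuous_RC_inv.
  - apply (continuous_minus (V := C_R_NormedModule)); [exact Hh | apply continuous_const].
  - intros E0; apply N; replace (h s) with ((h s - z) + z)%C by ring; rewrite E0; ring.
Qed.

(** Multiplication by [l] is real-linear, so a complex-differentiable function is
    differentiable over the reals at the points of the path, and the chain rule
    over the reals applies. *)
Lemma is_derive_comp_holomorphic (F : C -> C) (p : R -> C) (t : R) (l dp : C) :
  is_derive (K := C_AbsRing) (V := C_NormedModule) F (p t) l ->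
  is_derive_RC p t dp ->
  is_derive_RC (fun s => F (p s)) t (l * dp)%C.
Proof.
  intros [_ HF] Hp.
  assert (HF' : filterdiff (K := R_AbsRing) (U := C_R_NormedModule) (V := C_R_NormedModule)
                  F (locally (p t)) (fun y => (l * y)%C)).
  { split.
    - split.
      + intros x y; apply injective_projections; simpl; unfold plus; simpl; unfold plus; simpl; ring.
      + intros k x; apply injective_projections; simpl; unfold scal; simpl; unfold mult; simpl; ring.
      + exists (Cmod l + 1); split; [pose proof (Cmod_ge_0 l); lra|].
        intros x; rewrite !norm_C_R, Cmod_mult.
        pose proof (Cmod_ge_0 x); nra.
    - intros x Hx eps.
      apply (is_filter_lim_locally_unique (V := C_R_NormedModule)) in Hx; subst x.
      specialize (HF (p t) (fun P HP => HP) eps); apply locally_C in HF.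
      revert HF; apply filter_imp; intros y Hy.
      rewrite !norm_C_R.
      change (Cmod ((F y - F (p t)) - (y - p t) * l)%C <= eps * Cmod (y - p t)%C) in Hy.
      refine (Rle_trans _ _ _ (Req_le _ _ (f_equal Cmod _)) Hy).
      apply injective_projections; simpl; unfold minus, plus, opp; simpl; unfold plus, opp; simpl; ring. }
  unfold is_derive.
  apply (filterdiff_ext_lin _ (fun y => (l * scal (V := C_R_NormedModule) y dp)%C)).
  - exact (filterdiff_comp' p F t (fun y => scal y dp) (fun y => (l * y)%C) Hp HF').
  - intros y; apply injective_projections; simpl; unfold scal; simpl; unfold scal, mult; simpl; ring.
Qed.

(** * Polynomial primitives *)

Notation is_derive_CC := (is_derive (K := C_AbsRing) (V := AbsRing_NormedModule C_AbsRing)).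
(** The plane carries two normed-module structures over itself, with the same
    operations and norm but different balls.  Those of the target do not
    enter the derivative; holomorphy of a logarithm is given with the first
    structure, while products are differentiated with the second. *)
Lemma is_derive_CC_iff (F : C -> C) z l :
  is_derive (K := C_AbsRing) (V := C_NormedModule) F z l <-> is_derive_CC F z l.
Proof.
  split; intros [[h1 h2 h3] H]; (split; [constructor; assumption | exact H]).
Qed.


Lemma is_derive_CC_shift_pow (w z : C) (n : nat) :
  is_derive_CC (fun x => Cpow (x - w) (S n) / RtoC (INR (S n)))%C z (Cpow (z - w) n).
Proof.
  assert (H1 : is_derive_CC (fun x => (x - w)%C) z (RtoC 1)).
  { evar_last. 
    - apply (is_derive_minus (K := C_AbsRing) (fun x => x) (fun _ => w)).
      + apply is_derive_id.
      + apply is_derive_const.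
    - apply injective_projections; simpl; unfold minus, plus, opp, zero, one; simpl; ring. }
  assert (H2 : forall k, is_derive_CC (fun x => Cpow (x - w) k) z
     (RtoC (INR k) * Cpow (z - w) (pred k))%C).
  { induction k as [|k IH].
    - simpl. evar_last. apply (is_derive_const (K := C_AbsRing)).
      apply injective_projections; simpl; unfold zero; simpl; ring.
    - evar_last.
      apply (is_derive_mult (K := C_AbsRing) (fun x => (x - w)%C) (fun x => Cpow (x - w) k)
        z _ _ H1 IH).
      { intros; apply Cmult_comm. }
      rewrite S_INR, RtoC_plus. change plus with Cplus; change mult with Cmult.
      destruct k; simpl; ring. }
  assert (N : RtoC (INR (S n)) <> RtoC 0).
  { intros E; apply RtoC_inj in E; now apply (not_0_INR (S n)). }
  evar_last.
  - apply (is_derive_mult (K := C_AbsRing) (fun x => Cpow (x - w) (S n)) (fun _ => / RtoC (INR (S n)))%C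
      z _ _ (H2 (S n)) (is_derive_const _ _)).
    intros; apply Cmult_comm.
  - change plus with Cplus; change mult with Cmult; change zero with (RtoC 0).
    change (pred (S n)) with n. field. exact N.
Qed.

(** [x^n + x^(n-1) y + ... + y^n], the quotient of [x^(n+1) - y^(n+1)] by [x - y]. *)
Fixpoint geom_sum (x y : C) (n : nat) : C :=
  match n with O => RtoC 1 | S n => (y * geom_sum x y n + Cpow x (S n))%C end.

Lemma mul_sub_geom_sum x y n : ((x - y) * geom_sum x y n = Cpow x (S n) - Cpow y (S n))%C.
Proof.
  induction n as [|n IH]; [simpl; ring|].
  change (geom_sum x y (S n)) with (y * geom_sum x y n + Cpow x (S n))%C.
  replace ((x - y) * (y * geom_sum x y n + Cpow x (S n)))%C
    with (y * ((x - y) * geom_sum x y n) + (x - y) * Cpow x (S n))%C by ring.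
  rewrite IH; simpl; ring.
Qed.

Definition entire_primitive (F f : C -> C) : Prop := forall x, is_derive_CC F x (f x).

Lemma entire_primitive_comb F f G g c :
  entire_primitive F f -> entire_primitive G g ->
  entire_primitive (fun x => c * F x + G x)%C (fun x => c * f x + g x)%C.
Proof.
  intros HF HG x.
  evar_last.
  - apply (is_derive_plus (K := C_AbsRing) (V := AbsRing_NormedModule C_AbsRing) (fun x => c * F x)%C G); [|apply HG].
    apply (is_derive_mult (K := C_AbsRing) (fun _ => c) F x _ _ (is_derive_const _ _) (HF x)).
    intros; apply Cmult_comm.
  - change plus with Cplus; change mult with Cmult; change zero with (RtoC 0); ring.
Qed.

Lemma entire_primitive_zero (c : C) : entire_primitive (fun _ => c) (fun _ => RtoC 0).
Proof. intros x; exact (is_derive_const (K := C_AbsRing) (V := AbsRing_NormedModule C_AbsRing) c x). Qed.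

Lemma geom_sum_primitive w y n : exists G, entire_primitive G (fun x => geom_sum (x - w) y n).
Proof.
  induction n as [|n [G HG]].
  - exists (fun x => x); intros x; apply (is_derive_id (K := C_AbsRing)).
  - eexists.
    exact (entire_primitive_comb _ _ _ _ y HG (fun x => is_derive_CC_shift_pow w x (S n))).
Qed.

(** The divided difference of [P] at [z] is a polynomial, so it has a primitive [R].
    The four properties are linear in [Q], which leaves the monomials. *)
Lemma taylor_poly_primitive N b z0 z :
  exists P R dR : C -> C,
    entire_primitive P (taylor_poly N b z0) /\ P z0 = RtoC 0 /\
    entire_primitive R dR /\ (forall x, (x - z) * dR x = P x - P z)%C.
Proof.
  assert (mono : forall n, exists P R dR : C -> C,
    entire_primitive P (fun x => Cpow (x - z0) n) /\ P z0 = RtoC 0 /\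
    entire_primitive R dR /\ (forall x, (x - z) * dR x = P x - P z)%C).
  { intros n.
    destruct (geom_sum_primitive z0 (z - z0)%C n) as [G HG].
    exists (fun x => Cpow (x - z0) (S n) / RtoC (INR (S n)))%C.
    exists (fun x => / RtoC (INR (S n)) * G x + RtoC 1)%C.
    exists (fun x => / RtoC (INR (S n)) * geom_sum (x - z0) (z - z0) n + RtoC 0)%C.
    assert (E0 : (z0 - z0 = 0)%C) by ring.
    refine (conj _ (conj _ (conj _ _))).
    - intros x; apply is_derive_CC_shift_pow.
    - rewrite E0; simpl. unfold Cdiv; ring.
    - apply (entire_primitive_comb G (fun x => geom_sum (x - z0) (z - z0) n) (fun _ => RtoC 1) (fun _ => RtoC 0)).
      + exact HG.
      + apply entire_primitive_zero.
    - intros x.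
      replace (x - z)%C with ((x - z0) - (z - z0))%C at 1 by ring.
      rewrite Cplus_0_r, Cmult_assoc, (Cmult_comm _ (/ _)), <- Cmult_assoc, mul_sub_geom_sum.
      unfold Cdiv; ring. }
  assert (mono' : forall n c P0 R0 dR0 q,
    entire_primitive P0 q /\ P0 z0 = RtoC 0 /\
    entire_primitive R0 dR0 /\ (forall x, (x - z) * dR0 x = P0 x - P0 z)%C ->
    exists P R dR : C -> C,
    entire_primitive P (fun x => c * Cpow (x - z0) n + q x)%C /\ P z0 = RtoC 0 /\
    entire_primitive R dR /\ (forall x, (x - z) * dR x = P x - P z)%C).
  { intros n c P0 R0 dR0 q [H1 [H2 [H3 H4]]].
    destruct (mono n) as [P [R [dR [K1 [K2 [K3 K4]]]]]].
    do 3 eexists; refine (conj _ (conj _ (conj _ _))).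
    - exact (entire_primitive_comb _ _ _ _ c K1 H1).
    - simpl; rewrite K2, H2; ring.
    - exact (entire_primitive_comb _ _ _ _ c K3 H3).
    - intros x; simpl.
      replace ((x - z) * (c * dR x + dR0 x))%C with (c * ((x - z) * dR x) + (x - z) * dR0 x)%C by ring.
      rewrite K4, H4; ring. }
  unfold taylor_poly; induction N as [|N [P [R [dR H]]]].
  - destruct (mono' 0%nat (b 0%nat / RtoC (INR (fact 0)))%C
      (fun _ => RtoC 0) (fun _ => RtoC 0) (fun _ => RtoC 0) (fun _ => RtoC 0)) as [P [R [dR H]]].
    { refine (conj _ (conj eq_refl (conj _ _))); try apply entire_primitive_zero.
      intros; ring. }
    exists P, R, dR; destruct H as [H1 H]; split; [|exact H].
    intros x; specialize (H1 x). rewrite sum_O; cbv beta in H1; rewrite Cplus_0_r in H1; exact H1.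
  - destruct (mono' (S N) (b (S N) / RtoC (INR (fact (S N))))%C _ _ _ _ H) as [P' [R' [dR' H']]].
    exists P', R', dR'; destruct H' as [H1 H']; split; [|exact H'].
    intros x; specialize (H1 x). rewrite sum_Sn.
    change plus with Cplus. rewrite Cplus_comm; exact H1.
Qed.

Lemma taylor_poly_continuous_comp N b z0 (p : R -> C) t :
  continuous_RC p t -> continuous_RC (fun s => taylor_poly N b z0 (p s)) t.
Proof.
  intros Hp.
  assert (Hm : continuous_RC (fun s => (p s - z0)%C) t).
  { apply (continuous_minus (V := C_R_NormedModule)); [exact Hp | apply continuous_const]. }
  assert (Hc : forall n, continuous_RC (fun s => Cpow (p s - z0) n) t).
  { induction n as [|n IH]; simpl; [apply continuous_const|].
    apply continuous_RC_mult; assumption. }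
  unfold taylor_poly; induction N as [|N IH].
  - apply (continuous_ext (fun s => b 0%nat / RtoC (INR (fact 0)) * Cpow (p s - z0) 0)%C).
    { intros s; now rewrite sum_O. }
    apply continuous_RC_mult; [apply continuous_const | apply Hc].
  - apply (continuous_ext (fun s =>
      (sum_n (G := C_AbelianMonoid) (fun j => b j / RtoC (INR (fact j)) * Cpow (p s - z0) j)%C N
       + b (S N) / RtoC (INR (fact (S N))) * Cpow (p s - z0) (S N))%C)).
    { intros s; now rewrite sum_Sn. }
    apply (continuous_plus (V := C_R_NormedModule)); [exact IH|].
    apply continuous_RC_mult; [apply continuous_const | apply Hc].
Qed.

Lemma is_derive_entire_comp F f (p : R -> C) t dp :
  entire_primitive F f -> is_derive_RC p t dp ->
  is_derive_RC (fun s => F (p s)) t (f (p t) * dp)%C.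
Proof.
  intros HF Hp; apply is_derive_comp_holomorphic; [apply is_derive_CC_iff, HF | exact Hp].
Qed.

Lemma segment_int_primitive F f a b :
  entire_primitive F f ->
  (forall p t, continuous_RC p t -> continuous_RC (fun s => f (p s)) t) ->
  segment_int f a b = (F b - F a)%C.
Proof.
  intros HF Hc.
  set (p := fun s => (a + RtoC s * (b - a))%C).
  assert (Hp : forall s, is_derive_RC p s (b - a)%C).
  { intros s; apply is_derive_RC_iff; unfold p; split; simpl; auto_derive; trivial; ring. }
  unfold segment_int, CRInt.
  assert (E : is_RInt (V := C_R_NormedModule) (fun s => (f (p s) * (b - a))%C) 0 1
            (minus (F (p 1)) (F (p 0)))).
  { apply (is_RInt_derive (V := C_R_CompleteNormedModule) (fun s => F (p s))).
    - intros s _; apply (is_derive_entire_comp F f p s); auto.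
    - intros s _; apply continuous_RC_mult; [apply Hc | apply continuous_const].
      eapply is_derive_RC_continuous, Hp. }
  etransitivity; [apply (is_RInt_unique (V := C_R_CompleteNormedModule)), E|].
  replace (p 1) with b by (unfold p; ring).
  replace (p 0) with a by (unfold p; ring).
  reflexivity.
Qed.

(** * Integrals over an open interval *)

(** Stated on the open interval so that [H] may blow up at the ends, as logarithms
    of the distances to the ends do. *)
Lemma norm_increment_le {V : CompleteNormedModule R_AbsRing} (F f : R -> V) (H h : R -> R) (a b : R) :
  (forall s, a < s < b -> is_derive F s (f s) /\ continuous f s) ->
  (forall s, a < s < b -> is_derive H s (h s) /\ continuous h s) ->
  (forall s, a < s < b -> norm (f s) <= h s) ->
  forall x y, a < x < b -> a < y < b -> norm (minus (F y) (F x)) <= Rabs (H y - H x).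
Proof.
  intros HF HH Hle.
  assert (K : forall x y, a < x -> x <= y -> y < b -> norm (minus (F y) (F x)) <= H y - H x).
  { intros x y Hx Hxy Hy.
    assert (I : forall s, Rmin x y <= s <= Rmax x y -> a < s < b).
    { intros s; rewrite Rmin_left, Rmax_right by assumption; lra. }
    apply (norm_RInt_le f h x y _ _ Hxy).
    - intros s Hs; apply Hle; lra.
    - apply is_RInt_derive; intros s Hs; apply HF; auto.
    - apply (is_RInt_derive H h); intros s Hs; apply HH; auto. }
  intros x y Hx Hy; destruct (Rle_dec x y) as [L|L].
  - eapply Rle_trans; [apply K; lra | apply Rle_abs].
  - rewrite <- norm_opp, opp_minus.
    eapply Rle_trans; [apply (K y x); lra | rewrite Rabs_minus_sym; apply Rle_abs].
Qed.

(** Convergence of [H] makes its increments Cauchy along the filter, hence those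
    of [F]. *)
Lemma cauchy_limit_of_increment_le {V : CompleteNormedModule R_AbsRing}
  (Fl : (R -> Prop) -> Prop) {FF : ProperFilter Fl} (F : R -> V) (H : R -> R) (lH : R) (D : R -> Prop) :
  Fl D ->
  (forall x y, D x -> D y -> norm (minus (F y) (F x)) <= Rabs (H y - H x)) ->
  filterlim H Fl (locally lH) ->
  exists l, filterlim F Fl (locally l).
Proof.
  intros HD Hle HH.
  apply (filterlim_locally_cauchy (U := CompleteNormedModule.CompleteSpace _ V)).
  intros eps.
  destruct (proj2 (filterlim_locally_cauchy (F := Fl) (U := R_CompleteSpace) H)
    (ex_intro _ lH HH) eps) as [P [HP HPP]].
  exists (fun x => D x /\ P x); split.
  - now apply filter_and.
  - intros u v [Du Pu] [Dv Pv].
    apply (norm_compat1 (V := V)).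
    eapply Rle_lt_trans; [apply Hle; assumption|].
    exact (HPP u v Pu Pv).
Qed.

Lemma at_right_between a b : a < b -> at_right a (fun x => a < x < b).
Proof.
  intros H; assert (H0 : 0 < b - a) by lra.
  exists (mkposreal _ H0); intros y Hy Hay.
  unfold ball in Hy; simpl in Hy; unfold AbsRing_ball, abs, minus, plus, opp in Hy; simpl in Hy.
  apply Rabs_lt_between in Hy; lra.
Qed.

Lemma at_left_between a b : a < b -> at_left b (fun x => a < x < b).
Proof.
  intros H; assert (H0 : 0 < b - a) by lra.
  exists (mkposreal _ H0); intros y Hy Hay.
  unfold ball in Hy; simpl in Hy; unfold AbsRing_ball, abs, minus, plus, opp in Hy; simpl in Hy.
  apply Rabs_lt_between in Hy; lra.
Qed.

Lemma filter_prod_open_interval a b (P : R * R -> Prop) :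
  a < b -> (forall x y, a < x < b -> a < y < b -> P (x, y)) ->
  filter_prod (at_right a) (at_left b) P.
Proof.
  intros H HP.
  apply (Filter_prod _ _ _ (fun x => a < x < b) (fun x => a < x < b)).
  - now apply at_right_between.
  - now apply at_left_between.
  - exact HP.
Qed.

(** Stated with increments of [F] so that it serves both for an indefinite integral
    of [f] and for an explicit primitive. *)
Lemma is_RInt_gen_open_interval {V : NormedModule R_AbsRing} (f F : R -> V) (a b : R) (la lb : V) :
  a < b ->
  (forall x y, a < x < b -> a < y < b -> is_RInt f x y (minus (F y) (F x))) ->
  filterlim F (at_right a) (locally la) -> filterlim F (at_left b) (locally lb) ->
  is_RInt_gen f (at_right a) (at_left b) (minus lb la).
Proof.
  intros Hab HF Ha Hb P HP.
  assert (L : filterlim (fun xy : R * R => minus (F (snd xy)) (F (fst xy)))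
                (filter_prod (at_right a) (at_left b)) (locally (minus lb la))).
  { unfold minus; eapply filterlim_comp_2; [| |apply filterlim_plus].
    - eapply filterlim_comp; [apply filterlim_snd | exact Hb].
    - eapply filterlim_comp; [|apply filterlim_opp].
      eapply filterlim_comp; [apply filterlim_fst | exact Ha]. }
  assert (L' : filter_prod (at_right a) (at_left b)
            (fun xy => is_RInt f (fst xy) (snd xy) (minus (F (snd xy)) (F (fst xy))))).
  { apply filter_prod_open_interval; assumption. }
  assert (L'' : filter_prod (at_right a) (at_left b)
            (fun xy => P (minus (F (snd xy)) (F (fst xy))))) by exact (L P HP).
  refine (filter_imp _ _ _ (filter_and _ _ L' L'')); intros xy [H1 H2].
  exists (minus (F (snd xy)) (F (fst xy))); split; [exact H1 | exact H2].
Qed.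

(** Comparison test: the increments of an indefinite integral of [f] are bounded by
    those of the primitive [H] of the majorant. *)
Lemma ex_RInt_gen_comparison {V : CompleteNormedModule R_AbsRing}
  (f : R -> V) (H h : R -> R) (a b ha hb : R) :
  a < b ->
  (forall s, a < s < b -> continuous f s) ->
  (forall s, a < s < b -> is_derive H s (h s) /\ continuous h s) ->
  (forall s, a < s < b -> norm (f s) <= h s) ->
  filterlim H (at_right a) (locally ha) -> filterlim H (at_left b) (locally hb) ->
  ex_RInt_gen f (at_right a) (at_left b).
Proof.
  intros Hab Hf HH Hle La Lb.
  set (m := (a + b) / 2).
  set (F := fun x => RInt f m x).
  assert (Hm : a < m < b) by (unfold m; lra).
  assert (E : forall x y, a < x < b -> a < y < b -> ex_RInt f x y).
  { intros x y Hx Hy; apply (ex_RInt_continuous (V := V)); intros s Hs; apply Hf.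
    revert Hs; unfold Rmin, Rmax; destruct (Rle_dec x y); lra. }
  assert (DF : forall s, a < s < b -> is_derive F s (f s)).
  { intros s Hs; apply (is_derive_RInt f F m).
    - apply (locally_interval _ s a b); simpl; try apply Hs.
      intros y Hy1 Hy2; apply (RInt_correct (V := V)), E; split; assumption || apply Hm.
    - apply Hf, Hs. }
  assert (I : forall x y, a < x < b -> a < y < b -> norm (minus (F y) (F x)) <= Rabs (H y - H x)).
  { apply (norm_increment_le F f H h); auto. }
  destruct (cauchy_limit_of_increment_le (at_right a) F H ha _ (at_right_between a b Hab) I La) as [la Fa].
  destruct (cauchy_limit_of_increment_le (at_left b) F H hb _ (at_left_between a b Hab) I Lb) as [lb Fb].
  exists (minus lb la).
  apply (is_RInt_gen_open_interval f F); try assumption.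
  intros x y Hx Hy.
  apply is_RInt_derive; intros s Hs; [apply DF | apply Hf];
    revert Hs; unfold Rmin, Rmax; destruct (Rle_dec x y); lra.
Qed.

Lemma filterlim_zero_squeeze {V : NormedModule R_AbsRing} (Fl : (R -> Prop) -> Prop) {FF : Filter Fl}
  (f : R -> V) (g : R -> R) :
  Fl (fun s => norm (f s) <= g s) -> filterlim g Fl (locally 0) ->
  filterlim f Fl (locally (T := V) (@zero V)).
Proof.
  intros Hle Hg; apply filterlim_norm_zero.
  apply (filterlim_le_le (fun _ => 0) _ g (Finite 0)).
  - revert Hle; apply filter_imp; intros s Hs; split; [apply norm_ge_0 | exact Hs].
  - apply filterlim_const.
  - exact Hg.
Qed.

Lemma is_RInt_Re (f : R -> C) a b l :
  is_RInt (V := C_R_NormedModule) f a b l -> is_RInt (fun s => Re (f s)) a b (Re l).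
Proof. apply (is_RInt_fct_extend_fst (U := R_NormedModule) (V := R_NormedModule)). Qed.

Lemma is_RInt_gen_Re (f : R -> C) Fa Fb {FFa : Filter Fa} {FFb : Filter Fb} l :
  is_RInt_gen (V := C_R_NormedModule) f Fa Fb l ->
  is_RInt_gen (V := R_NormedModule) (fun s => Re (f s)) Fa Fb (Re l).
Proof.
  intros H P HP.
  assert (HP' : locally (T := C_UniformSpace) l (fun w => P (Re w))).
  { destruct l as [x y]; exact (continuous_fst x y P HP). }
  specialize (H _ HP'); unfold filtermapi in *; revert H.
  apply filter_imp; intros ab [y [H1 H2]].
  exists (Re y); split; [apply is_RInt_Re, H1 | exact H2].
Qed.

(** * Periodic functions *)

Lemma periodic_representative {A : Type} (f : R -> A) (T : R) :
  0 < T -> (forall t, f (t + T) = f t) -> forall t, exists r, 0 <= r < T /\ f t = f r.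
Proof.
  intros HT Hf t.
  assert (Hn : forall n x, f (x + INR n * T) = f x).
  { induction n as [|n IH]; intros x.
    - f_equal; simpl; ring.
    - rewrite <- (IH x), <- (Hf (x + INR n * T)), S_INR; f_equal; ring. }
  assert (Hz : forall k x, f (x + IZR k * T) = f x).
  { intros k x; destruct (Z_le_gt_dec 0 k) as [Hk|Hk].
    - rewrite <- (Z2Nat.id k Hk), <- INR_IZR_INZ; apply Hn.
    - rewrite <- (Hn (Z.to_nat (- k)) (x + IZR k * T)); f_equal.
      rewrite INR_IZR_INZ, Z2Nat.id by lia; rewrite opp_IZR; ring. }
  destruct (archimed (t / T)) as [H1 H2].
  exists (t - IZR (up (t / T) - 1) * T).
  rewrite minus_IZR.
  assert (E : t = t / T * T) by (field; lra).
  split.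
  - split; nra.
  - rewrite <- (Hz (up (t / T) - 1)%Z (t - (IZR (up (t / T)) - 1) * T)), minus_IZR; f_equal; ring.
Qed.

Lemma is_RInt_shift_period {V : CompleteNormedModule R_AbsRing} (f : R -> V) (T a : R) (l : V) :
  0 <= a <= T -> (forall t, f (t + T) = f t) ->
  is_RInt f a (a + T) l -> is_RInt f 0 T l.
Proof.
  intros Ha Hf H.
  assert (E1 : ex_RInt f a T).
  { apply (ex_RInt_Chasles_1 f a T (a + T)); [lra | now exists l]. }
  assert (E2 : ex_RInt f T (a + T)).
  { apply (ex_RInt_Chasles_2 f a T (a + T)); [lra | now exists l]. }
  destruct E1 as [l1 E1], E2 as [l2 E2].
  assert (E : plus l1 l2 = l).
  { rewrite <- (is_RInt_unique _ _ _ _ H); symmetry; apply is_RInt_unique.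
    eapply is_RInt_Chasles; eassumption. }
  assert (E3 : is_RInt f 0 a l2).
  { apply (is_RInt_ext (fun y => scal 1 (f (1 * y + T)))).
    - intros y _; rewrite Rmult_1_l; exact (eq_trans (scal_one _) (Hf y)).
    - apply (is_RInt_comp_lin f 1 T 0 a l2).
      replace (1 * 0 + T) with T by ring; replace (1 * a + T) with (a + T) by ring; exact E2. }
  rewrite <- E, plus_comm; eapply is_RInt_Chasles; eassumption.
Qed.

(** * Logarithms along a path *)

Lemma is_derive_Cexp_comp (L : R -> C) (t : R) (dL : C) :
  is_derive_RC L t dL -> is_derive_RC (fun s => Cexp (L s)) t (Cexp (L t) * dL)%C.
Proof.
  rewrite !is_derive_RC_iff; intros [H1 H2].
  assert (HE : is_derive (fun s => exp (Re (L s))) t (Re dL * exp (Re (L t)))).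
  { apply (is_derive_comp exp (fun s => Re (L s))); [apply is_derive_exp | exact H1]. }
  assert (HC : is_derive (fun s => cos (Im (L s))) t (Im dL * - sin (Im (L t)))).
  { apply (is_derive_comp cos (fun s => Im (L s))); [apply is_derive_cos | exact H2]. }
  assert (HS : is_derive (fun s => sin (Im (L s))) t (Im dL * cos (Im (L t)))).
  { apply (is_derive_comp sin (fun s => Im (L s))); [apply is_derive_sin | exact H2]. }
  split; simpl.
  - evar_last; [apply (is_derive_mult (K := R_AbsRing)); eauto; intros; apply Rmult_comm|].
    unfold plus, mult, Re, Im; simpl; ring.
  - evar_last; [apply (is_derive_mult (K := R_AbsRing)); eauto; intros; apply Rmult_comm|].
    unfold plus, mult, Re, Im; simpl; ring.
Qed.

Lemma Cmod_Cexp w : Cmod (Cexp w) = exp (Re w).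
Proof.
  unfold Cmod, Cexp; simpl.
  pose proof (sin2_cos2 (Im w)) as E; unfold Rsqr in E.
  set (x := exp (Re w)).
  replace (_ + _) with (x * x * (sin (Im w) * sin (Im w) + cos (Im w) * cos (Im w))) by ring.
  rewrite E, Rmult_1_r; apply sqrt_square; left; apply exp_pos.
Qed.

(** The derivative of [lg] at [p t] exists but its value is not given; it is read off
    by differentiating the identity [Cexp (lg (p s)) = p s - z]. *)
Lemma is_derive_log_comp (lg : C -> C) (z : C) (p : R -> C) (t : R) (dp : C) :
  locally t (fun s => Cexp (lg (p s)) = (p s - z)%C) ->
  ex_derive (K := C_AbsRing) (V := C_NormedModule) lg (p t) ->
  is_derive_RC p t dp ->
  is_derive_RC (fun s => lg (p s)) t (dp / (p t - z))%C.
Proof.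
  intros HE [l Hl] Hp.
  pose proof (is_derive_comp_holomorphic lg p t l dp Hl Hp) as HL.
  assert (E : (Cexp (lg (p t)) * (l * dp) = dp)%C).
  { apply (is_derive_RC_unique (fun s => Cexp (lg (p s))) t).
    - exact (is_derive_Cexp_comp (fun s => lg (p s)) t _ HL).
    - apply (is_derive_ext_loc (fun s => (p s - z)%C)).
      + revert HE; apply filter_imp; intros s Hs; now symmetry.
      + apply is_derive_RC_minus_const, Hp. }
  pose proof (locally_singleton _ _ HE) as E1; cbv beta in E1.
  assert (N : (p t - z)%C <> RtoC 0).
  { rewrite <- E1; intros E0; apply (f_equal Cmod) in E0.
    rewrite Cmod_Cexp, Cmod_0 in E0; pose proof (exp_pos (Re (lg (p t)))); lra. }
  rewrite <- E at 1; rewrite E1.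
  replace ((p t - z) * (l * dp) / (p t - z))%C with (l * dp)%C by (field; exact N).
  exact HL.
Qed.

(** * Growth of a logarithm at the end points of a regular arc *)

Lemma is_derive_RC_increment (p : R -> C) (t : R) (dp : C) (eps : R) :
  is_derive_RC p t dp -> 0 < eps ->
  exists d, 0 < d /\ forall s, Rabs (s - t) < d ->
    Cmod ((p s - p t) - RtoC (s - t) * dp)%C <= eps * Rabs (s - t).
Proof.
  intros [_ H] He.
  destruct (H t (fun P HP => HP) (mkposreal eps He)) as [d Hd].
  exists d; split; [apply cond_pos|]; intros s Hs.
  specialize (Hd s Hs).
  rewrite norm_C_R in Hd.
  refine (Rle_trans _ _ _ (Req_le _ _ (f_equal Cmod _)) Hd).
  apply injective_projections; simpl; unfold minus, plus, opp, scal; simpl;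
    unfold plus, opp, scal, mult; simpl; ring.
Qed.

Lemma is_derive_RC_local_lower (p : R -> C) (t : R) (dp : C) :
  is_derive_RC p t dp -> dp <> RtoC 0 ->
  exists d c, 0 < d /\ 0 < c /\ forall s, Rabs (s - t) < d -> c * Rabs (s - t) <= Cmod (p s - p t)%C.
Proof.
  intros H N.
  pose proof (proj1 (Cmod_gt_0 dp) N) as Hc.
  destruct (is_derive_RC_increment p t dp (Cmod dp / 2) H) as [d [Hd Hb]]; [lra|].
  exists d, (Cmod dp / 2); split; [exact Hd|split; [lra|]]; intros s Hs; specialize (Hb s Hs).
  assert (T : Cmod (RtoC (s - t) * dp)%C <= Cmod (p s - p t)%C + Cmod ((p s - p t) - RtoC (s - t) * dp)%C).
  { replace (RtoC (s - t) * dp)%C with ((p s - p t) + - ((p s - p t) - RtoC (s - t) * dp))%C at 1 by ring.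
    rewrite <- (Cmod_opp ((p s - p t) - _)%C); apply Cmod_triangle. }
  rewrite Cmod_mult, Cmod_R in T; lra.
Qed.

Lemma is_derive_RC_local_upper (p : R -> C) (t : R) (dp : C) :
  is_derive_RC p t dp ->
  exists d, 0 < d /\ forall s, Rabs (s - t) < d -> Cmod (p s - p t)%C <= (Cmod dp + 1) * Rabs (s - t).
Proof.
  intros H.
  destruct (is_derive_RC_increment p t dp 1 H) as [d [Hd Hb]]; [lra|].
  exists d; split; [exact Hd|]; intros s Hs; specialize (Hb s Hs).
  replace (p s - p t)%C with (((p s - p t) - RtoC (s - t) * dp) + RtoC (s - t) * dp)%C by ring.
  eapply Rle_trans; [apply Cmod_triangle|].
  rewrite Cmod_mult, Cmod_R; lra.
Qed.

(** Near each end the chord is comparable with the parameter distance because the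
    velocity does not vanish; in between it has a positive minimum. *)
Lemma chord_lower_bound (p : R -> C) (a b : R) (da db : C) :
  a < b ->
  (forall s, a <= s <= b -> continuous_RC p s) ->
  is_derive_RC p a da -> da <> RtoC 0 -> is_derive_RC p b db -> db <> RtoC 0 ->
  p b = p a -> (forall s, a < s < b -> p s <> p a) ->
  exists k, 0 < k /\ forall s, a < s < b -> k * Rmin (s - a) (b - s) <= Cmod (p s - p a)%C.
Proof.
  intros Hab Hc Ha Na Hb Nb Eab Hinj.
  destruct (is_derive_RC_local_lower p a da Ha Na) as [d1 [c1 [Hd1 [Hc1 L1]]]].
  destruct (is_derive_RC_local_lower p b db Hb Nb) as [d2 [c2 [Hd2 [Hc2 L2]]]].
  (* At most half the length, so that [a + d / 2, b - d / 2] is not empty. *)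
  set (d := Rmin (Rmin d1 d2) ((b - a) / 2)).
  assert (Hd : 0 < d /\ d <= d1 /\ d <= d2 /\ d <= (b - a) / 2).
  { unfold d; repeat apply conj; repeat apply Rmin_glb_lt; try lra;
      eauto using Rle_trans, Rmin_l, Rmin_r. }
  destruct (continuity_ab_min (fun s => Cmod (p s - p a)%C) (a + d / 2) (b - d / 2)) as [mx [Hmx Imx]].
  { lra. }
  { intros s Hs; apply continuity_pt_filterlim.
    apply continuous_RC_Cmod.
    apply (continuous_minus (V := C_R_NormedModule)); [apply Hc; lra | apply continuous_const]. }
  assert (Hm : 0 < Cmod (p mx - p a)%C).
  { apply Cmod_gt_0; intros E; apply (Hinj mx); [lra|].
    replace (p mx) with ((p mx - p a) + p a)%C by ring; rewrite E; ring. }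
  set (m := Cmod (p mx - p a)%C) in *.
  exists (Rmin (Rmin c1 c2) (m / (b - a))); split.
  { repeat apply Rmin_glb_lt; try assumption; apply Rdiv_lt_0_compat; lra. }
  intros s Hs.
  assert (K1 := Rmin_l (Rmin c1 c2) (m / (b - a))).
  assert (K2 := Rmin_r (Rmin c1 c2) (m / (b - a))).
  assert (K3 := Rmin_l c1 c2). assert (K4 := Rmin_r c1 c2).
  set (k := Rmin (Rmin c1 c2) (m / (b - a))) in *.
  assert (Hk : 0 < k).
  { unfold k; repeat apply Rmin_glb_lt; try assumption; apply Rdiv_lt_0_compat; lra. }
  assert (M1 := Rmin_l (s - a) (b - s)). assert (M2 := Rmin_r (s - a) (b - s)).
  assert (M0 : 0 < Rmin (s - a) (b - s)) by (apply Rmin_glb_lt; lra).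
  set (r := Rmin (s - a) (b - s)) in *.
  destruct (Rlt_dec (s - a) d) as [S1|S1]; [|destruct (Rlt_dec (b - s) d) as [S2|S2]].
  - assert (A1 : Rabs (s - a) = s - a) by (apply Rabs_pos_eq; lra).
    specialize (L1 s); rewrite A1 in L1.
    apply Rle_trans with (c1 * (s - a)); [nra | apply L1; lra].
  - assert (A1 : Rabs (s - b) = b - s) by (rewrite Rabs_minus_sym; apply Rabs_pos_eq; lra).
    specialize (L2 s); rewrite A1, Eab in L2.
    apply Rle_trans with (c2 * (b - s)); [nra | apply L2; lra].
  - apply Rle_trans with m; [|apply Hmx; lra].
    apply Rle_trans with (m / (b - a) * (b - a)); [nra | right; field; lra].
Qed.

(** Apply [ln y <= y] to [y = sqrt x] and to [y = / sqrt x]. *)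
Lemma Rabs_ln_le_inv_sqrt (x : R) : 0 < x -> Rabs (ln x) <= 2 * (x + 1) / sqrt x.
Proof.
  intros Hx.
  pose proof (sqrt_lt_R0 x Hx) as Hs.
  assert (E : x = sqrt x * sqrt x) by (symmetry; apply sqrt_sqrt; lra).
  assert (El : ln x = ln (sqrt x) + ln (sqrt x)).
  { rewrite E at 1; now rewrite ln_mult. }
  assert (U : forall y, 0 < y -> ln y <= y).
  { intros y Hy; rewrite <- (ln_exp y) at 2.
    apply ln_le; [exact Hy|]. pose proof (exp_ineq1_le y); lra. }
  assert (U1 := U _ Hs).
  assert (Hi : 0 < / sqrt x) by now apply Rinv_0_lt_compat.
  assert (U2 := U _ Hi). rewrite ln_Rinv in U2 by exact Hs.
  replace (2 * (x + 1) / sqrt x) with (2 * sqrt x + 2 * / sqrt x).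
  - apply Rabs_le; lra.
  - revert Hs E; generalize (sqrt x); intros y Hy ->; field; lra.
Qed.

(** Integrating the bound on the derivative gives logarithms of the distances to the
    ends, which are dominated by inverse square roots. *)
Lemma inv_sqrt_growth_of_derivative_bound (L u : R -> C) (a b K : R) :
  a < b ->
  (forall s, a < s < b -> is_derive_RC L s (u s) /\ continuous_RC u s) ->
  (forall s, a < s < b -> Cmod (u s) <= K * (/ (s - a) + / (b - s))) ->
  exists M, forall s, a < s < b -> Cmod (L s) <= M * (/ sqrt (s - a) + / sqrt (b - s)).
Proof.
  intros Hab HL Hu.
  (* At the midpoint the primitive [H] of the bound is zero. *)
  set (m := (a + b) / 2).
  assert (Hm : a < m < b) by (unfold m; lra).
  assert (HK : 0 <= K).
  { specialize (Hu m Hm); pose proof (Cmod_ge_0 (u m)).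
    assert (0 < / (m - a)) by (apply Rinv_0_lt_compat; lra).
    assert (0 < / (b - m)) by (apply Rinv_0_lt_compat; lra). nra. }
  set (H := fun s => K * (ln (s - a) - ln (b - s))).
  assert (I := norm_increment_le (V := C_R_CompleteNormedModule) L u H
    (fun s => K * (/ (s - a) + / (b - s))) a b HL).
  assert (I' : forall s, a < s < b -> Cmod (L s - L m)%C <= Rabs (H s - H m)).
  { intros s Hs; rewrite <- norm_C_R; apply I; try assumption.
    - intros y Hy; split.
      + unfold H; auto_derive; [repeat split; lra | field; lra].
      + apply (ex_derive_continuous (V := R_NormedModule)); auto_derive; repeat split; lra.
    - intros y Hy; rewrite norm_C_R; now apply Hu. }
  exists (Cmod (L m) * sqrt (b - a) + 2 * K * (b - a + 1)).
  intros s Hs.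
  assert (E0 : H m = 0).
  { unfold H; replace (m - a) with (b - m) by (unfold m; field); ring. }
  specialize (I' s Hs); rewrite E0, Rminus_0_r in I'.
  assert (T : Cmod (L s) <= Cmod (L m) + Cmod (L s - L m)%C).
  { replace (L s) with (L m + (L s - L m))%C at 1 by ring; apply Cmod_triangle. }
  assert (B1 := Rabs_ln_le_inv_sqrt (s - a) ltac:(lra)).
  assert (B2 := Rabs_ln_le_inv_sqrt (b - s) ltac:(lra)).
  assert (B : Rabs (H s) <= K * (Rabs (ln (s - a)) + Rabs (ln (b - s)))).
  { unfold H; rewrite Rabs_mult, (Rabs_pos_eq K HK).
    apply Rmult_le_compat_l; [exact HK|].
    unfold Rminus; eapply Rle_trans; [apply Rabs_triang|]; rewrite Rabs_Ropp; lra. }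
  assert (Q1 : 0 < / sqrt (s - a)) by (apply Rinv_0_lt_compat, sqrt_lt_R0; lra).
  assert (Q2 : 0 < / sqrt (b - s)) by (apply Rinv_0_lt_compat, sqrt_lt_R0; lra).
  unfold Rdiv in B1, B2.
  set (q1 := / sqrt (s - a)) in *; set (q2 := / sqrt (b - s)) in *.
  assert (B1' : Rabs (ln (s - a)) <= 2 * (b - a + 1) * q1) by nra.
  assert (B2' : Rabs (ln (b - s)) <= 2 * (b - a + 1) * q2) by nra.
  assert (O : 1 <= sqrt (b - a) * q1).
  { assert (0 < sqrt (s - a)) by (apply sqrt_lt_R0; lra).
    apply Rmult_le_reg_r with (sqrt (s - a)); [assumption|].
    unfold q1; rewrite Rmult_assoc, Rinv_l by lra.
    rewrite Rmult_1_l, Rmult_1_r; apply sqrt_le_1; lra. }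
  pose proof (Cmod_ge_0 (L m)).
  assert (0 <= sqrt (b - a)) by apply sqrt_pos.
  assert (K * (Rabs (ln (s - a)) + Rabs (ln (b - s))) <= K * (2 * (b - a + 1) * (q1 + q2))).
  { apply Rmult_le_compat_l; lra. }
  assert (Cmod (L m) <= Cmod (L m) * sqrt (b - a) * (q1 + q2)).
  { rewrite Rmult_assoc. rewrite <- (Rmult_1_r (Cmod (L m))) at 1.
    apply Rmult_le_compat_l; nra. }
  lra.
Qed.

(** The majorant has the primitive [2 M (sqrt (s - a) - sqrt (b - s))], which is
    continuous up to both ends. *)
Lemma ex_RInt_gen_inv_sqrt_bound (f : R -> C) (a b M : R) :
  a < b ->
  (forall s, a < s < b -> continuous_RC f s) ->
  (forall s, a < s < b -> Cmod (f s) <= M * (/ sqrt (s - a) + / sqrt (b - s))) ->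
  ex_RInt_gen (V := C_R_NormedModule) f (at_right a) (at_left b).
Proof.
  intros Hab Hf HM.
  set (H := fun s => 2 * M * (sqrt (s - a) - sqrt (b - s))).
  assert (HC : forall s, continuous H s).
  { intros s; unfold H.
    apply @continuous_mult; [apply continuous_const|].
    apply @continuous_minus; apply continuous_comp; try apply continuous_sqrt;
      apply @continuous_minus; first [apply continuous_id | apply continuous_const]. }
  apply (ex_RInt_gen_comparison (V := C_R_CompleteNormedModule) f H
    (fun s => M * (/ sqrt (s - a) + / sqrt (b - s))) a b (H a) (H b)).
  - exact Hab.
  - exact Hf.
  - intros s Hs.
    assert (0 < sqrt (s - a)) by (apply sqrt_lt_R0; lra).
    assert (0 < sqrt (b - s)) by (apply sqrt_lt_R0; lra).
    split.
    + unfold H; auto_derive; [repeat split; lra | unfold Rminus in *; field; lra].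
    + apply (ex_derive_continuous (V := R_NormedModule)); auto_derive.
      unfold Rminus in *; repeat split; lra.
  - intros s Hs; rewrite norm_C_R; now apply HM.
  - eapply filterlim_filter_le_1; [apply filter_le_within | apply HC].
  - eapply filterlim_filter_le_1; [apply filter_le_within | apply HC].
Qed.

(** A function that vanishes to first order at an end beats the inverse square root
    growth there: near that end [|s - e|] is at most a multiple of
    [(s - a) * (b - s)], whose product with the majorant tends to 0 at both ends. *)
Lemma vanishing_product (L F : R -> C) (a b M e : R) (dF : C) (Fl : (R -> Prop) -> Prop) {FF : Filter Fl} :
  a < b -> e = a \/ e = b -> filter_le Fl (locally e) -> Fl (fun s => a < s < b) ->
  (forall s, a < s < b -> Cmod (L s) <= M * (/ sqrt (s - a) + / sqrt (b - s))) ->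
  is_derive_RC F e dF -> F e = RtoC 0 ->
  filterlim (fun s => L s * F s)%C Fl (locally (T := C_UniformSpace) (RtoC 0)).
Proof.
  intros Hab He Hle Hin HM HF F0.
  destruct (is_derive_RC_local_upper F e dF HF) as [d [Hd HC]].
  pose proof (Cmod_ge_0 dF) as HdF.
  set (C0 := Cmod dF + 1) in *.
  set (g := fun s => M * C0 * (2 / (b - a)) * (sqrt (s - a) * (b - s) + (s - a) * sqrt (b - s))).
  apply (filterlim_zero_squeeze (V := C_R_NormedModule) Fl _ g).
  - assert (Hd' : 0 < Rmin d ((b - a) / 2)) by (apply Rmin_glb_lt; lra).
    assert (Hn : Fl (fun s => Rabs (s - e) < Rmin d ((b - a) / 2))).
    { apply Hle; exists (mkposreal _ Hd'); intros y Hy; exact Hy. }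
    refine (filter_imp _ _ _ (filter_and _ _ Hin Hn)); intros s [Hs Hse].
    assert (S1 : Rabs (s - e) < d) by (eapply Rlt_le_trans; [exact Hse | apply Rmin_l]).
    assert (S2 : Rabs (s - e) < (b - a) / 2) by (eapply Rlt_le_trans; [exact Hse | apply Rmin_r]).
    specialize (HC s S1); specialize (HM s Hs).
    replace (F s - F e)%C with (F s) in HC by (rewrite F0; ring).
    rewrite norm_C_R, Cmod_mult.
    pose proof (Cmod_ge_0 (L s)); pose proof (Cmod_ge_0 (F s)).
    assert (P1 : Rabs (s - e) <= 2 / (b - a) * ((s - a) * (b - s))).
    { apply Rmult_le_reg_r with (b - a); [lra|].
      replace (2 / (b - a) * ((s - a) * (b - s)) * (b - a)) with (2 * ((s - a) * (b - s))) by (field; lra).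
      destruct He as [-> | ->].
      - rewrite Rabs_pos_eq in * by lra; nra.
      - rewrite Rabs_minus_sym, Rabs_pos_eq in * by lra; nra. }
    assert (Q1 : 0 < sqrt (s - a)) by (apply sqrt_lt_R0; lra).
    assert (Q2 : 0 < sqrt (b - s)) by (apply sqrt_lt_R0; lra).
    assert (E1 : s - a = sqrt (s - a) * sqrt (s - a)) by (symmetry; apply sqrt_sqrt; lra).
    assert (E2 : b - s = sqrt (b - s) * sqrt (b - s)) by (symmetry; apply sqrt_sqrt; lra).
    apply Rle_trans with (M * (/ sqrt (s - a) + / sqrt (b - s)) * (C0 * (2 / (b - a) * ((s - a) * (b - s))))).
    + apply Rmult_le_compat; try assumption.
      eapply Rle_trans; [exact HC|]; apply Rmult_le_compat_l; [unfold C0; lra | exact P1].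
    + right; unfold g; cbv beta.
      assert (Hba : b - a <> 0) by lra.
      revert E1 E2 Q1 Q2 Hba; generalize (sqrt (s - a)) (sqrt (b - s)); generalize (s - a) (b - s) (b - a).
      intros X Y B x y -> -> Hx Hy HB; field; lra.
  - eapply filterlim_filter_le_1; [exact Hle|].
    assert (G0 : g e = 0).
    { unfold g; destruct He as [-> | ->];
        rewrite (Rminus_diag_eq _ _ eq_refl), sqrt_0; ring. }
    rewrite <- G0.
    assert (C1 : continuous (fun s => sqrt (s - a)) e).
    { apply continuous_comp; [|apply continuous_sqrt].
      apply @continuous_minus; [apply continuous_id | apply continuous_const]. }
    assert (C2 : continuous (fun s => sqrt (b - s)) e).
    { apply continuous_comp; [|apply continuous_sqrt].
      apply @continuous_minus; [apply continuous_const | apply continuous_id]. }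
    assert (C3 : continuous g e); [|exact C3].
    unfold g; apply @continuous_mult; [apply continuous_const|].
    apply @continuous_plus; apply @continuous_mult; try assumption;
      apply @continuous_minus; first [apply continuous_const | apply continuous_id].
Qed.

(** * The boundary curve *)

Lemma boundary_param_derive D gam (H : boundary_param D gam) t : is_derive_RC gam t (Cderive gam t).
Proof.
  destruct (bp_C2 _ _ H t) as [HC _].
  destruct (locally_singleton _ _ HC 1%nat ltac:(lia)) as [H1 H2].
  apply is_derive_RC_iff; split; apply Derive_correct; assumption.
Qed.

Lemma boundary_param_continuous D gam (H : boundary_param D gam) t : continuous_RC gam t.
Proof. eapply is_derive_RC_continuous, (boundary_param_derive D gam H). Qed.

Lemma boundary_param_continuous_Cderive D gam (H : boundary_param D gam) t :
  continuous_RC (Cderive gam) t.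
Proof.
  destruct (bp_C2 _ _ H t) as [HC _].
  destruct (locally_singleton _ _ HC 2%nat ltac:(lia)) as [H1 H2].
  apply continuous_RC_iff; split.
  - exact (ex_derive_continuous (V := R_NormedModule) _ _ H1).
  - exact (ex_derive_continuous (V := R_NormedModule) _ _ H2).
Qed.

Lemma Cderive_periodic (gam : R -> C) T :
  (forall t, gam (t + T) = gam t) -> forall t, Cderive gam (t + T) = Cderive gam t.
Proof.
  intros H t; unfold Cderive, Cderive_n; f_equal.
  - rewrite <- (Derive_n_comp_trans (fun s => Re (gam s)) 1 t T).
    apply Derive_n_ext; intros s; now rewrite H.
  - rewrite <- (Derive_n_comp_trans (fun s => Im (gam s)) 1 t T).
    apply Derive_n_ext; intros s; now rewrite H.
Qed.

Lemma two_PI_pos : 0 < 2 * PI.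
Proof. pose proof PI_RGT_0; lra. Qed.

Lemma boundary_param_frontier D gam (H : boundary_param D gam) t : frontier D (gam t).
Proof.
  destruct (periodic_representative gam (2 * PI) two_PI_pos (bp_periodic _ _ H) t) as [r [Hr ->]].
  apply (bp_boundary _ _ H); now exists r.
Qed.

Lemma boundary_param_injective D gam (H : boundary_param D gam) a s :
  0 <= a < 2 * PI -> a < s < a + 2 * PI -> gam s <> gam a.
Proof.
  intros Ha Hs E.
  destruct (Rlt_dec s (2 * PI)) as [L|L].
  - assert (s = a) by (apply (bp_simple _ _ H); auto; lra); lra.
  - assert (s - 2 * PI = a); [|lra].
    apply (bp_simple _ _ H); try lra.
    rewrite <- E, <- (bp_periodic _ _ H); f_equal; ring.
Qed.

Lemma continuous_on_comp_path {U : UniformSpace} D (g : C -> U) (p : R -> C) t :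
  continuous_on (T := C_UniformSpace) D g -> continuous_RC p t -> (forall s, D (p s)) ->
  continuous (fun s => g (p s)) t.
Proof.
  intros Hg Hp HD.
  apply (filterlim_comp _ _ _ p g _ (within D (locally (p t)))); [|apply Hg, HD].
  intros P HP; apply Hp in HP; unfold filtermap in *; revert HP.
  apply filter_imp; intros s Hs; apply Hs, HD.
Qed.

(** The density of [phi ds] with respect to the parameter. *)
Definition density (gam : R -> C) (phi : C -> R) (s : R) : R :=
  phi (gam s) * Cmod (Cderive gam s).

Lemma density_continuous D gam phi (H : boundary_param D gam) t :
  continuous_on (T := C_UniformSpace) (U := R_UniformSpace) (frontier D) phi ->
  continuous (density gam phi) t.
Proof.
  intros Hphi; apply @continuous_mult.
  - apply (continuous_on_comp_path (frontier D)); [exact Hphi| |].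
    + apply (boundary_param_continuous D gam H).
    + apply (boundary_param_frontier D gam H).
  - apply continuous_RC_Cmod, (boundary_param_continuous_Cderive D gam H).
Qed.

Lemma psi_Cderive gam (phi : C -> R) psi :
  (forall t, Cderive gam t <> RtoC 0) ->
  (forall t, psi (gam t) =
     (RtoC (phi (gam t)) * (RtoC (Cmod (Cderive gam t)) / Cderive gam t))%C) ->
  forall t, (psi (gam t) * Cderive gam t)%C = RtoC (density gam phi t).
Proof.
  intros N H t; rewrite H; unfold density; rewrite RtoC_mult; field; apply N.
Qed.

Lemma layer_integrand_density gam phi z s :
  layer_integrand gam phi z s = ln (Cmod (z - gam s)%C) * density gam phi s.
Proof. unfold layer_integrand, density; ring. Qed.

(** * The contour integral of the logarithm times a polynomial *)

(** Integration by parts: the terms that contain [dg / (gam s - z)] cancel, since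
    [dV] is the divided difference of [P]. *)
Lemma is_derive_log_by_parts (gam Lam : R -> C) (P Q V dV : C -> C) (z dg : C) (s : R) :
  is_derive_RC gam s dg -> gam s <> z ->
  is_derive_RC Lam s (dg / (gam s - z))%C ->
  entire_primitive P Q -> entire_primitive V dV ->
  (forall x, (x - z) * dV x = P x - P z)%C ->
  is_derive_RC (fun s => Lam s * (P (gam s) - P z) - V (gam s))%C s (Lam s * (Q (gam s) * dg))%C.
Proof.
  intros Hg N HL HP HV E.
  assert (N' : (gam s - z)%C <> RtoC 0).
  { intros E0; apply N; replace (gam s) with ((gam s - z) + z)%C by ring; rewrite E0; ring. }
  evar_last.
  - apply (is_derive_minus (K := R_AbsRing) (V := C_R_NormedModule)
             (fun s => Lam s * (P (gam s) - P z))%C (fun s => V (gam s))).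
    + apply is_derive_RC_mult; [exact HL|].
      apply is_derive_RC_minus_const, (is_derive_entire_comp P Q gam s dg HP Hg).
    + apply (is_derive_entire_comp V dV gam s dg HV Hg).
  - cbv beta; change minus with Cminus; rewrite <- (E (gam s)); field; exact N'.
Qed.

Lemma inv_two_PI_Ci : (/ (RtoC (2 * PI) * Ci))%C = (0, - / (2 * PI)).
Proof.
  pose proof PI_RGT_0.
  apply injective_projections; simpl; field; lra.
Qed.

Lemma two_PI_Ci_neq_0 : (RtoC (2 * PI) * Ci)%C <> RtoC 0.
Proof.
  pose proof PI_RGT_0. intros E; apply (f_equal snd) in E; simpl in E; lra.
Qed.

Lemma Im_div_two_PI_Ci (A : C) : Im (/ (RtoC (2 * PI) * Ci) * A)%C = - / (2 * PI) * Re A.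
Proof. rewrite inv_two_PI_Ci; unfold Re, Im; simpl; ring. Qed.

Lemma log_branch_Re z c lg w : log_branch z c lg -> ~ on_cut c w -> ln (Cmod (z - w)%C) = Re (lg w).
Proof.
  intros [_ H] N; destruct (H w N) as [_ E].
  replace (z - w)%C with (- (w - z))%C by ring.
  rewrite Cmod_opp, <- E, Cmod_Cexp; apply ln_exp.
Qed.

Lemma contour_integrand_split gam psi phi lg Q s :
  (psi (gam s) * Cderive gam s)%C = RtoC (density gam phi s) ->
  contour_integrand gam (fun zeta => lg zeta * (psi zeta - Q zeta))%C s =
  (lg (gam s) * RtoC (density gam phi s) - lg (gam s) * (Q (gam s) * Cderive gam s))%C.
Proof. intros <-; unfold contour_integrand; ring. Qed.

(** * Points off the boundary *)

(** The factor [k] is the increment of the logarithm over the period in units of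
    [2 pi i], which will be 1 for interior and 0 for exterior points. *)
Lemma off_boundary_identity (D : C -> Prop) (gam : R -> C) (phi : C -> R) (psi lg Q P V dV : C -> C)
  (Lam : R -> C) (z k : C) (a : R) :
  boundary_param D gam ->
  continuous_on (T := C_UniformSpace) (U := R_UniformSpace) (frontier D) phi ->
  (forall t, (psi (gam t) * Cderive gam t)%C = RtoC (density gam phi t)) ->
  0 <= a < 2 * PI ->
  (forall p t, continuous_RC p t -> continuous_RC (fun s => Q (p s)) t) ->
  entire_primitive P Q -> P (gam a) = RtoC 0 ->
  entire_primitive V dV -> (forall x, (x - z) * dV x = P x - P z)%C ->
  (forall s, gam s <> z) ->
  (forall s, is_derive_RC Lam s (Cderive gam s / (gam s - z))%C) ->
  (forall s, a < s < a + 2 * PI -> lg (gam s) = Lam s /\ ln (Cmod (z - gam s)%C) = Re (Lam s)) ->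
  (Lam (a + 2 * PI)%R - Lam a)%C = (RtoC (2 * PI) * Ci * k)%C ->
  let f := fun zeta : C => (lg zeta * (psi zeta - Q zeta))%C in
  ex_RInt (V := R_NormedModule) (layer_integrand gam phi z) 0 (2 * PI) /\
  ex_contour_int gam f /\
  single_layer_potential gam phi z =
    Im (/ (RtoC (2 * PI) * Ci) * contour_int gam f - k * P z)%C.
Proof.
  intros Hgam Hphi Hpsi Ha HQ HP P0 HV HVP Nz HLam Hlg Hk f.
  pose proof two_PI_pos as HT.
  set (b := a + 2 * PI) in *.
  assert (Hgab : gam b = gam a) by apply (bp_periodic _ _ Hgam).
  assert (Hmm : forall s, Rmin a b < s < Rmax a b -> a < s < b).
  { unfold b; intros s; rewrite Rmin_left, Rmax_right; lra. }
  assert (CL : forall s, continuous_RC Lam s).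
  { intros s; eapply is_derive_RC_continuous, HLam. }
  assert (IA : ex_RInt (V := C_R_NormedModule) (fun s => Lam s * RtoC (density gam phi s))%C a b).
  { apply (ex_RInt_continuous (V := C_R_CompleteNormedModule)); intros s _.
    apply continuous_RC_mult; [apply CL | apply continuous_RtoC].
    eapply density_continuous; eauto. }
  destruct IA as [A IA].
  assert (IB : is_RInt (V := C_R_NormedModule) (fun s => Lam s * (Q (gam s) * Cderive gam s))%C a b
                 (- (RtoC (2 * PI) * Ci * k * P z))%C).
  { evar_last.
    - apply (is_RInt_derive (V := C_R_CompleteNormedModule)
        (fun s => Lam s * (P (gam s) - P z) - V (gam s))%C); intros s _.
      + apply (is_derive_log_by_parts gam Lam P Q V dV z); auto.
        apply (boundary_param_derive D gam Hgam).
      + apply continuous_RC_mult; [apply CL|apply continuous_RC_mult].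
        * apply HQ, (boundary_param_continuous D gam Hgam).
        * apply (boundary_param_continuous_Cderive D gam Hgam).
    - change minus with Cminus; rewrite Hgab, P0, <- Hk; ring. }
  assert (IL : is_RInt (layer_integrand gam phi z) 0 (2 * PI) (Re A)).
  { apply (is_RInt_shift_period (V := R_CompleteNormedModule) _ (2 * PI) a); [lra| |].
    - intros t; unfold layer_integrand.
      now rewrite (Cderive_periodic gam _ (bp_periodic _ _ Hgam)), (bp_periodic _ _ Hgam).
    - apply (is_RInt_ext (fun s => Re (Lam s * RtoC (density gam phi s))%C)).
      + intros s Hs; apply Hmm in Hs; rewrite layer_integrand_density.
        rewrite (proj2 (Hlg s Hs)); unfold Re; simpl; ring.
      + apply is_RInt_Re, IA. }
  assert (IC : is_RInt (V := C_R_NormedModule) (contour_integrand gam f) 0 (2 * PI)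
                 (A - - (RtoC (2 * PI) * Ci * k * P z))%C).
  { apply (is_RInt_shift_period (V := C_R_CompleteNormedModule) _ (2 * PI) a); [lra| |].
    - intros t; unfold contour_integrand.
      now rewrite (Cderive_periodic gam _ (bp_periodic _ _ Hgam)), (bp_periodic _ _ Hgam).
    - apply (is_RInt_ext (V := C_R_NormedModule)
        (fun s => minus (Lam s * RtoC (density gam phi s))%C (Lam s * (Q (gam s) * Cderive gam s))%C)).
      + intros s Hs; apply Hmm in Hs; unfold f.
        rewrite (contour_integrand_split gam psi phi lg Q s (Hpsi s)), (proj1 (Hlg s Hs)).
        reflexivity.
      + exact (is_RInt_minus (V := C_R_NormedModule) _ _ _ _ _ _ IA IB). }
  split; [now exists (Re A)|split; [eexists; exact IC|]].
  unfold single_layer_potential, contour_int, CRInt.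
  rewrite (is_RInt_unique (V := R_CompleteNormedModule) _ _ _ _ IL).
  rewrite (is_RInt_unique (V := C_R_CompleteNormedModule) _ _ _ _ IC).
  rewrite <- Im_div_two_PI_Ci; f_equal.
  generalize two_PI_Ci_neq_0; generalize (RtoC (2 * PI) * Ci)%C; intros c Hc; field; exact Hc.
Qed.

Lemma is_derive_log_branch_comp z c lg (p : R -> C) a b s dp :
  log_branch z c lg -> (forall s, a < s < b -> ~ on_cut c (p s)) ->
  a < s < b -> is_derive_RC p s dp ->
  is_derive_RC (fun s => lg (p s)) s (dp / (p s - z))%C.
Proof.
  intros [_ H] Hp Hs Hd.
  apply is_derive_log_comp; [|apply H, Hp, Hs|exact Hd].
  apply (locally_interval _ s a b); simpl; try apply Hs.
  intros y Hy1 Hy2; apply H, Hp; split; assumption.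
Qed.

(** For an interior point the branch has a jump at the parameter where the cut crosses
    the curve, but its derivative extends continuously; integrating this derivative
    gives a determination of the logarithm without jump. *)
Lemma primitive_extension (L u : R -> C) (a b : R) :
  a < b -> (forall s, continuous_RC u s) ->
  (forall s, a < s < b -> is_derive_RC L s (u s)) ->
  exists Lam : R -> C, (forall s, is_derive_RC Lam s (u s)) /\
    (forall s, a < s < b -> L s = Lam s).
Proof.
  intros Hab Hu HL.
  set (m := (a + b) / 2).
  assert (Hm : a < m < b) by (unfold m; lra).
  exists (fun s => (CRInt u m s + L m)%C); split.
  - intros s; evar_last.
    + apply (is_derive_plus (V := C_R_NormedModule) (fun s => CRInt u m s) (fun _ => L m)).
      * apply (is_derive_RInt (V := C_R_NormedModule) u (fun s => CRInt u m s) m s); [|apply Hu].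
        apply filter_forall; intros y.
        apply (RInt_correct (V := C_R_CompleteNormedModule)).
        apply (ex_RInt_continuous (V := C_R_CompleteNormedModule)); intros; apply Hu.
      * apply (is_derive_const (V := C_R_NormedModule)).
    + apply (plus_zero_r (G := C_R_NormedModule)).
  - intros s Hs.
    assert (E : is_RInt (V := C_R_NormedModule) u m s (minus (L s) (L m))).
    { apply (is_RInt_derive (V := C_R_CompleteNormedModule)); [|intros; apply Hu].
      intros y Hy; apply HL; revert Hy; unfold Rmin, Rmax; destruct (Rle_dec m s); lra. }
    unfold CRInt; rewrite (is_RInt_unique (V := C_R_CompleteNormedModule) _ _ _ _ E).
    change minus with Cminus; ring.
Qed.

Lemma increment_of_log_winding D gam z Lam a :
  boundary_param D gam -> 0 <= a < 2 * PI -> (forall s, gam s <> z) ->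
  (forall s, is_derive_RC Lam s (Cderive gam s / (gam s - z))%C) ->
  (Lam (a + 2 * PI)%R - Lam a)%C = (RtoC (2 * PI) * Ci * winding_number gam z)%C.
Proof.
  intros H Ha N HL.
  set (u := contour_integrand gam (fun w => / (w - z))%C).
  assert (E : is_RInt (V := C_R_NormedModule) u a (a + 2 * PI)
            (minus (Lam (a + 2 * PI)) (Lam a))).
  { apply (is_RInt_ext (V := C_R_NormedModule) (fun s => Cderive gam s / (gam s - z))%C).
    { intros s _; unfold u, contour_integrand, Cdiv; apply Cmult_comm. }
    apply (is_RInt_derive (V := C_R_CompleteNormedModule)); intros s _; [apply HL|].
    apply continuous_quotient; auto.
    - eapply boundary_param_continuous_Cderive, H.
    - eapply boundary_param_continuous, H. }
  apply (is_RInt_shift_period (V := C_R_CompleteNormedModule)) in E; [|lra|].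
  - unfold winding_number, contour_int, CRInt; fold u.
    rewrite (is_RInt_unique (V := C_R_CompleteNormedModule) _ _ _ _ E).
    change minus with Cminus.
    generalize two_PI_Ci_neq_0; generalize (RtoC (2 * PI) * Ci)%C; intros k Hk; field; exact Hk.
  - intros t; unfold u, contour_integrand.
    now rewrite (Cderive_periodic gam _ (bp_periodic _ _ H)), (bp_periodic _ _ H).
Qed.

(** * Points on the boundary *)

Lemma continuous_bounded (g : R -> R) a b :
  a <= b -> (forall s, continuous g s) -> exists G, 0 <= G /\ forall s, a <= s <= b -> Rabs (g s) <= G.
Proof.
  intros Hab Hg.
  destruct (continuity_ab_maj (fun s => Rabs (g s)) a b Hab) as [mx [Hmx _]].
  { intros s _; apply continuity_pt_filterlim, continuous_Rabs_comp, Hg. }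
  exists (Rabs (g mx)); split; [apply Rabs_pos | exact Hmx].
Qed.

(** The derivative of the branch is the velocity divided by the chord, and the chord
    is bounded below by the distance to the nearer end of the period. *)
Lemma log_growth_at_boundary_point D gam lg a :
  boundary_param D gam -> 0 <= a < 2 * PI ->
  (forall s, a < s < a + 2 * PI ->
     is_derive_RC (fun s => lg (gam s)) s (Cderive gam s / (gam s - gam a))%C) ->
  exists M, forall s, a < s < a + 2 * PI ->
    Cmod (lg (gam s)) <= M * (/ sqrt (s - a) + / sqrt (a + 2 * PI - s)).
Proof.
  intros H Ha HL.
  pose proof two_PI_pos as HT; set (b := a + 2 * PI) in *.
  assert (Hab : a < b) by (unfold b; lra).
  assert (Hinj : forall s, a < s < b -> gam s <> gam a).
  { intros s Hs; apply (boundary_param_injective D gam H); assumption. }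
  destruct (chord_lower_bound gam a b (Cderive gam a) (Cderive gam b) Hab) as [k [Hk Hlow]];
    eauto using boundary_param_continuous, boundary_param_derive, bp_regular.
  { apply (bp_periodic _ _ H). }
  destruct (continuous_bounded (fun s => Cmod (Cderive gam s)) a b) as [G [HG0 HG]]; [lra| |].
  { intros s; apply continuous_RC_Cmod; eapply boundary_param_continuous_Cderive, H. }
  apply (inv_sqrt_growth_of_derivative_bound (fun s => lg (gam s))
           (fun s => Cderive gam s / (gam s - gam a))%C a b (G / k) Hab).
  - intros s Hs; split; [apply HL, Hs|].
    apply continuous_quotient; eauto using boundary_param_continuous, boundary_param_continuous_Cderive.
  - intros s Hs.
    assert (Nz : (gam s - gam a)%C <> RtoC 0).
    { intros E0; apply (Hinj s Hs); replace (gam s) with ((gam s - gam a) + gam a)%C by ring; rewrite E0; ring. }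
    rewrite Cmod_div by exact Nz.
    specialize (HG s ltac:(lra)); rewrite Rabs_pos_eq in HG by apply Cmod_ge_0.
    specialize (Hlow s Hs).
    assert (M0 : 0 < Rmin (s - a) (b - s)) by (apply Rmin_glb_lt; lra).
    assert (I : / Cmod (gam s - gam a)%C <= / (k * Rmin (s - a) (b - s))).
    { apply Rinv_le_contravar; [nra | exact Hlow]. }
    assert (J : / Rmin (s - a) (b - s) <= / (s - a) + / (b - s)).
    { assert (0 < / (s - a)) by (apply Rinv_0_lt_compat; lra).
      assert (0 < / (b - s)) by (apply Rinv_0_lt_compat; lra).
      unfold Rmin; destruct (Rle_dec (s - a) (b - s)); lra. }
    assert (Hk' : 0 < / k) by now apply Rinv_0_lt_compat.
    rewrite Rinv_mult in I.
    unfold Rdiv; apply Rle_trans with (G * (/ k * / Rmin (s - a) (b - s))).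
    + apply Rmult_le_compat; try assumption; [apply Cmod_ge_0|].
      left; apply Rinv_0_lt_compat; now apply Cmod_gt_0.
    + rewrite Rmult_assoc; apply Rmult_le_compat_l; [exact HG0|].
      apply Rmult_le_compat_l; lra.
Qed.

(** The primitive from [is_derive_log_by_parts] has the limit [- V (gam a)] at both
    ends of the period, because its first term vanishes there. *)
Lemma on_boundary_identity (D : C -> Prop) (gam : R -> C) (phi : C -> R) (psi lg Q P V dV : C -> C) (a : R) :
  boundary_param D gam ->
  continuous_on (T := C_UniformSpace) (U := R_UniformSpace) (frontier D) phi ->
  (forall t, (psi (gam t) * Cderive gam t)%C = RtoC (density gam phi t)) ->
  0 <= a < 2 * PI ->
  (forall p t, continuous_RC p t -> continuous_RC (fun s => Q (p s)) t) ->
  entire_primitive P Q ->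
  entire_primitive V dV -> (forall x, (x - gam a) * dV x = P x - P (gam a))%C ->
  (forall s, a < s < a + 2 * PI ->
     is_derive_RC (fun s => lg (gam s)) s (Cderive gam s / (gam s - gam a))%C) ->
  (forall s, a < s < a + 2 * PI -> ln (Cmod (gam a - gam s)%C) = Re (lg (gam s))) ->
  let f := fun zeta : C => (lg zeta * (psi zeta - Q zeta))%C in
  ex_period_int (layer_integrand gam phi (gam a)) a /\
  ex_contour_int_sing gam f a /\
  single_layer_operator gam phi a = Im (/ (RtoC (2 * PI) * Ci) * contour_int_sing gam f a)%C.
Proof.
  intros Hgam Hphi Hpsi Ha HQ HP HV HVP HL Hln f.
  pose proof two_PI_pos as HT.
  destruct (log_growth_at_boundary_point D gam lg a Hgam Ha HL) as [M HM].
  unfold single_layer_operator, period_int, contour_int_sing, Cperiod_int,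
    ex_period_int, ex_contour_int_sing, ex_Cperiod_int.
  set (b := a + 2 * PI) in *.
  assert (Hab : a < b) by (unfold b; lra).
  assert (Hgab : gam b = gam a) by apply (bp_periodic _ _ Hgam).
  assert (Hw : forall s, continuous (density gam phi) s) by (intros; eapply density_continuous; eauto).
  assert (CL : forall s, a < s < b -> continuous_RC (fun s => lg (gam s)) s).
  { intros s Hs; eapply is_derive_RC_continuous, HL, Hs. }
  destruct (continuous_bounded (density gam phi) a b) as [G [HG0 HG]]; [lra|exact Hw|].
  destruct (ex_RInt_gen_inv_sqrt_bound (fun s => lg (gam s) * RtoC (density gam phi s))%C a b (M * G) Hab)
    as [A IA].
  { intros s Hs; apply continuous_RC_mult; [apply CL, Hs | apply continuous_RtoC, Hw]. }
  { intros s Hs; rewrite Cmod_mult, Cmod_R.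
    replace (M * G * (/ sqrt (s - a) + / sqrt (b - s))) with (M * (/ sqrt (s - a) + / sqrt (b - s)) * G) by ring.
    apply Rmult_le_compat; [apply Cmod_ge_0 | apply Rabs_pos | apply HM, Hs | apply HG; lra]. }
  set (W := fun s => (lg (gam s) * (P (gam s) - P (gam a)) - V (gam s))%C).
  assert (LW : forall Fl e, Filter Fl -> (e = a \/ e = b) -> filter_le Fl (locally e) ->
            Fl (fun s => a < s < b) -> filterlim W Fl (locally (T := C_UniformSpace) (- V (gam a))%C)).
  { intros Fl e FF He Hle Hin.
    assert (Ee : gam e = gam a) by (destruct He as [-> | ->]; auto).
    replace (- V (gam a))%C with (RtoC 0 + - V (gam a))%C by ring.
    apply (filterlim_comp_2 (G := locally (T := C_UniformSpace) (RtoC 0))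
             (H := locally (T := C_UniformSpace) (- V (gam a))%C)
             (fun s => (lg (gam s) * (P (gam s) - P (gam a)))%C) (fun s => (- V (gam s))%C) Cplus).
    - apply (vanishing_product _ (fun s => P (gam s) - P (gam a))%C a b M e (Q (gam e) * Cderive gam e)%C); auto.
      + apply is_derive_RC_minus_const, is_derive_entire_comp; [exact HP|].
        apply (boundary_param_derive D gam Hgam).
      + rewrite Ee; ring.
    - eapply filterlim_filter_le_1; [exact Hle|].
      rewrite <- Ee.
      apply (continuous_opp (V := C_R_NormedModule) (fun s => V (gam s))).
      eapply is_derive_RC_continuous, is_derive_entire_comp; [exact HV|].
      apply (boundary_param_derive D gam Hgam).
    - apply (filterlim_plus (V := C_R_NormedModule)). }
  assert (IB : is_RInt_gen (V := C_R_NormedModule) (fun s => lg (gam s) * (Q (gam s) * Cderive gam s))%C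
                (at_right a) (at_left b) (minus (- V (gam a)) (- V (gam a)))%C).
  { apply (is_RInt_gen_open_interval (V := C_R_NormedModule) _ W); [exact Hab| | |].
    - intros x y Hx Hy.
      assert (I : forall s, Rmin x y <= s <= Rmax x y -> a < s < b).
      { intros s; unfold Rmin, Rmax; destruct (Rle_dec x y); lra. }
      apply (is_RInt_derive (V := C_R_CompleteNormedModule)); intros s Hs; apply I in Hs.
      + apply (is_derive_log_by_parts gam (fun s => lg (gam s)) P Q V dV (gam a)); auto.
        * apply (boundary_param_derive D gam Hgam).
        * apply (boundary_param_injective D gam Hgam); assumption.
      + apply continuous_RC_mult; [apply CL, Hs|apply continuous_RC_mult].
        * apply HQ, (boundary_param_continuous D gam Hgam).
        * apply (boundary_param_continuous_Cderive D gam Hgam).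
    - apply (LW _ a); auto; [apply at_right_proper_filter | apply filter_le_within | now apply at_right_between].
    - apply (LW _ b); auto; [apply at_left_proper_filter | apply filter_le_within | now apply at_left_between]. }
  assert (I : forall x y s, a < x < b -> a < y < b -> Rmin x y < s < Rmax x y -> a < s < b).
  { intros x y s; unfold Rmin, Rmax; destruct (Rle_dec x y); lra. }
  assert (IL : is_RInt_gen (V := R_NormedModule) (layer_integrand gam phi (gam a))
                 (at_right a) (at_left b) (Re A)).
  { apply (is_RInt_gen_ext (fun s => Re (lg (gam s) * RtoC (density gam phi s))%C)).
    - apply filter_prod_open_interval; [exact Hab|]; intros x y Hx Hy s Hs.
      apply (I x y) in Hs; try assumption.
      rewrite layer_integrand_density, Hln by exact Hs; unfold Re; simpl; ring.
    - apply is_RInt_gen_Re; [apply at_right_proper_filter | apply at_left_proper_filter | exact IA]. }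
  assert (IC : is_RInt_gen (V := C_R_NormedModule) (contour_integrand gam f) (at_right a) (at_left b) A).
  { assert (EA : (A - (- V (gam a) - - V (gam a)))%C = A) by ring.
    rewrite <- EA.
    apply (is_RInt_gen_ext (V := C_R_NormedModule)
        (fun s => minus (lg (gam s) * RtoC (density gam phi s))%C (lg (gam s) * (Q (gam s) * Cderive gam s))%C)).
    - apply filter_prod_open_interval; [exact Hab|]; intros x y Hx Hy s Hs.
      unfold f; rewrite (contour_integrand_split gam psi phi lg Q s (Hpsi s)); reflexivity.
    - exact (is_RInt_gen_minus (V := C_R_NormedModule) _ _ _ _ IA IB). }
  split; [now exists (Re A) | split; [now exists A|]].
  rewrite (is_RInt_gen_unique (V := R_CompleteNormedModule) _ _ IL).
  rewrite (is_RInt_gen_unique (V := C_R_CompleteNormedModule) _ _ IC).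
  symmetry; apply Im_div_two_PI_Ci.
Qed.

(** * The representation formulas *)

Lemma not_frontier_cases D z : ~ frontier D z -> D z \/ exterior D z.
Proof.
  intros H; destruct (excluded_middle_informative (D z)) as [HD|HD]; [now left|].
  right; intros HC; apply H; split; [exact HC|].
  intros P HP; exists z; split; [exact HD | exact (locally_singleton _ _ HP)].
Qed.

Theorem theorem3p3
  (Omega : C -> Prop) (gam : R -> C) (phi : C -> R) (psi : C -> C) (N : nat)
  (HOmega : simply_connected_domain Omega)
  (Hbounded : bounded_set Omega)
  (Hgam : boundary_param Omega gam)
  (Hphi : continuous_on (T := C_UniformSpace) (U := R_UniformSpace)
            (frontier Omega) phi)
  (Hpsi_cont : continuous_on (T := C_UniformSpace) (U := C_UniformSpace)
                 (frontier Omega) psi)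
  (Hpsi : forall t, psi (gam t) =
     (RtoC (phi (gam t)) * (RtoC (Cmod (Cderive gam t)) / Cderive gam t))%C) :
  (forall (t0 : R) (b : nat -> C),
     0 <= t0 < 2 * PI ->
     cont_diff_at N gam t0 ->
     cont_diff_at N (fun t => psi (gam t)) t0 ->
     is_interpolant gam psi N t0 b ->
     forall (z : C) (c : R -> C) (lg : C -> C),
       ~ frontier Omega z ->
       log_branch z c lg ->
       (Omega z -> cut_exits_at Omega c (gam t0)) ->
       (exterior Omega z -> cut_avoids_boundary Omega c) ->
       let Q := taylor_poly N b (gam t0) in
       let f := fun zeta : C => (lg zeta * (psi zeta - Q zeta))%C in
       ex_RInt (V := R_NormedModule) (layer_integrand gam phi z) 0 (2 * PI) /\
       ex_contour_int gam f /\
       single_layer_potential gam phi z =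
         Im (/ (RtoC (2 * PI) * Ci) * contour_int gam f
             - indicator Omega z * segment_int Q (gam t0) z)%C) /\
  (class_C N gam ->
   class_C N (fun t => psi (gam t)) ->
   forall (t : R) (b : nat -> C),
     0 <= t < 2 * PI ->
     is_interpolant gam psi N t b ->
     forall (c : R -> C) (lg : C -> C),
       log_branch (gam t) c lg ->
       cut_meets_boundary_only_at Omega c (gam t) ->
       let Q := taylor_poly N b (gam t) in
       let f := fun zeta : C => (lg zeta * (psi zeta - Q zeta))%C in
       ex_period_int (layer_integrand gam phi (gam t)) t /\
       ex_contour_int_sing gam f t /\
       single_layer_operator gam phi t =
         Im (/ (RtoC (2 * PI) * Ci) * contour_int_sing gam f t)%C).
Proof.
  pose proof two_PI_pos as HT.
  pose proof (psi_Cderive gam phi psi (bp_regular _ _ Hgam) Hpsi) as Hdens.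
  pose proof (boundary_param_frontier Omega gam Hgam) as Hfr.
  pose proof (boundary_param_derive Omega gam Hgam) as Hder.
  split.
  - intros t0 b Ht0 _ _ _ z c lg Nz Hlg Hin Hout.
    cbv zeta; set (Q := taylor_poly N b (gam t0)).
    assert (HQ : forall p t, continuous_RC p t -> continuous_RC (fun s => Q (p s)) t).
    { intros p t; apply taylor_poly_continuous_comp. }
    destruct (taylor_poly_primitive N b (gam t0) z) as [P [V [dV [HP [P0 [HV HVP]]]]]]; fold Q in HP.
    rewrite (segment_int_primitive P Q (gam t0) z HP HQ), P0.
    replace (P z - RtoC 0)%C with (P z) by ring.
    assert (Hgz : forall s, gam s <> z) by (intros s E; apply Nz; rewrite <- E; apply Hfr).
    destruct (not_frontier_cases Omega z Nz) as [Hz|Hz].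
    + destruct (Hin Hz) as [_ Hcut].
      assert (Hoff : forall s, t0 < s < t0 + 2 * PI -> ~ on_cut c (gam s)).
      { intros s Hs Hc; apply (boundary_param_injective Omega gam Hgam t0 s Ht0 Hs).
        apply Hcut; [exact Hc | apply Hfr]. }
      destruct (primitive_extension (fun s => lg (gam s)) (fun s => Cderive gam s / (gam s - z))%C
                  t0 (t0 + 2 * PI)) as [Lam [HLam HLeq]]; [lra| | |].
      { intros s; apply continuous_quotient;
          eauto using boundary_param_continuous, boundary_param_continuous_Cderive. }
      { intros s Hs; eapply is_derive_log_branch_comp; eauto. }
      apply (off_boundary_identity Omega gam phi psi lg Q P V dV Lam z _ t0); auto.
      * intros s Hs; rewrite <- HLeq by exact Hs; split; [reflexivity|].
        eapply log_branch_Re; eauto.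
      * rewrite (increment_of_log_winding Omega gam z Lam t0 Hgam Ht0 Hgz HLam).
        rewrite (bp_ccw _ _ Hgam z Hz); unfold indicator.
        destruct (excluded_middle_informative (Omega z)); [reflexivity | contradiction].
    + assert (Hoff : forall s, ~ on_cut c (gam s)).
      { intros s Hc; exact (Hout Hz _ Hc (Hfr s)). }
      apply (off_boundary_identity Omega gam phi psi lg Q P V dV (fun s => lg (gam s)) z _ t0); auto.
      (* The whole curve avoids the cut: any open interval around [s] will do. *)
      * intros s; apply (is_derive_log_branch_comp z c lg gam (s - 1) (s + 1)); auto; lra.
      * intros s Hs; split; [reflexivity|]; eapply log_branch_Re; eauto.
      * rewrite (bp_periodic _ _ Hgam); unfold indicator.
        destruct (excluded_middle_informative (Omega z)) as [HO|]; [|ring].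
        exfalso; apply Hz; intros W HW; exists z; split; [exact HO | exact (locally_singleton _ _ HW)].
  - intros _ _ t b Ht _ c lg Hlg Hcut.
    cbv zeta; set (Q := taylor_poly N b (gam t)).
    destruct (taylor_poly_primitive N b (gam t) (gam t)) as [P [V [dV [HP [P0 [HV HVP]]]]]]; fold Q in HP.
    assert (Hoff : forall s, t < s < t + 2 * PI -> ~ on_cut c (gam s)).
    { intros s Hs Hc; apply (boundary_param_injective Omega gam Hgam t s Ht Hs).
      apply Hcut; [exact Hc | apply Hfr]. }
    apply (on_boundary_identity Omega gam phi psi lg Q P V dV t); auto.
    + intros p s; apply taylor_poly_continuous_comp.
    + intros s Hs; eapply is_derive_log_branch_comp; eauto.
    + intros s Hs; eapply log_branch_Re; eauto.
Qed.
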